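(* Let $r_1,r_2,m_1,m_2>0$ with $r_1+r_2\le1$ and $m_1+m_2=1$, and let $\mu$ be the self-similar measure on $[0,1]$ determined by $S_1(x)=r_1x$, $S_2(x)=r_2x+1-r_2$ and weights $(m_1,m_2)$. For all $z\in\mathbb{R}$, with the abbreviations $z_1=\sqrt{r_1m_1}\,z$ and $z_2=\sqrt{r_2m_2}\,z$, $$\sin_\mu^N(z)=\sqrt{\tfrac{m_1}{r_1}}\sin_\mu^N(z_1)\cos_\mu^D(z_2)+\sqrt{\tfrac{m_2}{r_2}}\cos_\mu^N(z_1)\sin_\mu^N(z_2)-[1-(r_1+r_2)]\sqrt{\tfrac{m_1m_2}{r_1r_2}}\,z\,\sin_\mu^N(z_1)\sin_\mu^N(z_2),$$ $$\sin_\mu^D(z)=\sqrt{\tfrac{r_1}{m_1}}\sin_\mu^D(z_1)\cos_\mu^N(z_2)+\sqrt{\tfrac{r_2}{m_2}}\cos_\mu^D(z_1)\sin_\mu^D(z_2)+[1-(r_1+r_2)]\,z\,\cos_\mu^D(z_1)\cos_\mu^N(z_2),$$ $$\cos_\mu^N(z)=\cos_\mu^N(z_1)\cos_\mu^N(z_2)-\sqrt{\tfrac{r_2m_1}{r_1m_2}}\sin_\mu^N(z_1)\sin_\mu^D(z_2)-[1-(r_1+r_2)]\sqrt{\tfrac{m_1}{r_1}}\,z\,\sin_\mu^N(z_1)\cos_\mu^N(z_2),$$ $$\cos_\mu^D(z)=\cos_\mu^D(z_1)\cos_\mu^D(z_2)-\sqrt{\tfrac{r_1m_2}{r_2m_1}}\sin_\mu^D(z_1)\sin_\mu^N(z_2)-[1-(r_1+r_2)]\sqrt{\tfrac{m_2}{r_2}}\,z\,\cos_\mu^D(z_1)\sin_\mu^N(z_2).$$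 Furthermore, $\sin_\mu^N,\sin_\mu^D,\cos_\mu^N,\cos_\mu^D$ are the only (real) analytic functions on $\mathbb{R}$ that solve this system of four functional equations and satisfy the conditions that $\sin_\mu^N$ and $\sin_\mu^D$ are odd, $\cos_\mu^N$ and $\cos_\mu^D$ are even, $\lim_{z\to0}\frac{\sin_\mu^N(z)}{z}=\lim_{z\to0}\frac{\sin_\mu^D(z)}{z}=1$ and $\cos_\mu^N(0)=\cos_\mu^D(0)=1$. (That is: if real analytic functions $f_1,f_2,g_1,g_2$ on $\mathbb{R}$ satisfy the system and these conditions when put in place of $\sin_\mu^N,\sin_\mu^D,\cos_\mu^N,\cos_\mu^D$ respectively, then $f_1=\sin_\mu^N$, $f_2=\sin_\mu^D$, $g_1=\cos_\mu^N$, $g_2=\cos_\mu^D$.)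
   Context: The self-similar measure $\mu$ is the unique Borel probability measure on $[0,1]$ with $\mu(B)=m_1\,\mu(S_1^{-1}(B))+m_2\,\mu(S_2^{-1}(B))$ for all Borel sets $B$ (it is non-atomic). Functions $p_n,q_n$: for $x\in[0,1]$ put $p_0(x)=q_0(x)=1$ and, for $n\ge1$: for odd $n$, $p_n(x)=\int_0^x p_{n-1}(t)\,d\mu(t)$ and $q_n(x)=\int_0^x q_{n-1}(t)\,dt$; for even $n$, $p_n(x)=\int_0^x p_{n-1}(t)\,dt$ and $q_n(x)=\int_0^x q_{n-1}(t)\,d\mu(t)$. Write $p_n=p_n(1)$, $q_n=q_n(1)$. For $z\in\mathbb{R}$ (absolutely convergent series): $\sin_\mu^N(z)=\sum_{n\ge0}(-1)^n p_{2n+1}z^{2n+1}$, $\sin_\mu^D(z)=\sum_{n\ge0}(-1)^n q_{2n+1}z^{2n+1}$, $\cos_\mu^N(z)=\sum_{n\ge0}(-1)^n p_{2n}z^{2n}$, $\cos_\mu^D(z)=\sum_{n\ge0}(-1)^n q_{2n}z^{2n}$. *)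

(* Defs.v *)
From HB Require Import structures.
From mathcomp Require Import all_boot all_order all_algebra.
From mathcomp Require Import all_classical all_reals all_analysis.
Import Order.TTheory GRing.Theory Num.Theory.
Import numFieldNormedType.Exports.

Set Implicit Arguments.
Unset Strict Implicit.
Unset Printing Implicit Defensive.

Local Open Scope classical_set_scope.
Local Open Scope ring_scope.

Definition S1 {R : realType} (r1 x : R) : R := r1 * x.
Definition S2 {R : realType} (r2 x : R) : R := r2 * x + 1 - r2.

(* A Borel probability measure on [0, 1] is represented as a Borel probability
   measure on R giving mass 1 to [0, 1]. *)
Definition self_similar {R : realType} (r1 r2 m1 m2 : R)
    (mu : probability (measurableTypeR R) R) : Prop :=
  mu `[0, 1]%classic = 1%E /\
  forall B : set (measurableTypeR R), measurable B ->
    mu B = (m1%:E * mu (S1 r1 @^-1` B) + m2%:E * mu (S2 r2 @^-1` B))%E.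

Section iterated_integrals.
Context {R : realType} (mu : probability (measurableTypeR R) R).

Fixpoint pfun (n : nat) (x : R) : R :=
  if n is k.+1 then
    if odd k.+1 then \int[mu]_(t in `[0, x]) pfun k t
    else \int[lebesgue_measure]_(t in `[0, x]) pfun k t
  else 1.

Fixpoint qfun (n : nat) (x : R) : R :=
  if n is k.+1 then
    if odd k.+1 then \int[lebesgue_measure]_(t in `[0, x]) qfun k t
    else \int[mu]_(t in `[0, x]) qfun k t
  else 1.

Definition sin_muN (z : R) : R :=
  limn (series (fun n => (-1) ^+ n * pfun n.*2.+1 1 * z ^+ n.*2.+1)).
Definition sin_muD (z : R) : R :=
  limn (series (fun n => (-1) ^+ n * qfun n.*2.+1 1 * z ^+ n.*2.+1)).
Definition cos_muN (z : R) : R :=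
  limn (series (fun n => (-1) ^+ n * pfun n.*2 1 * z ^+ n.*2)).
Definition cos_muD (z : R) : R :=
  limn (series (fun n => (-1) ^+ n * qfun n.*2 1 * z ^+ n.*2)).

End iterated_integrals.

Definition trig_system {R : realType} (r1 r2 m1 m2 : R)
    (sN sD cN cD : R -> R) : Prop :=
  forall z : R,
  let z1 := Num.sqrt (r1 * m1) * z in
  let z2 := Num.sqrt (r2 * m2) * z in
  [/\ sN z = Num.sqrt (m1 / r1) * sN z1 * cD z2
             + Num.sqrt (m2 / r2) * cN z1 * sN z2
             - (1 - (r1 + r2)) * Num.sqrt ((m1 * m2) / (r1 * r2)) * z
               * sN z1 * sN z2,
      sD z = Num.sqrt (r1 / m1) * sD z1 * cN z2
             + Num.sqrt (r2 / m2) * cD z1 * sD z2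
             + (1 - (r1 + r2)) * z * cD z1 * cN z2,
      cN z = cN z1 * cN z2
             - Num.sqrt ((r2 * m1) / (r1 * m2)) * sN z1 * sD z2
             - (1 - (r1 + r2)) * Num.sqrt (m1 / r1) * z * sN z1 * cN z2
    & cD z = cD z1 * cD z2
             - Num.sqrt ((r1 * m2) / (r2 * m1)) * sD z1 * sN z2
             - (1 - (r1 + r2)) * Num.sqrt (m2 / r2) * z * cD z1 * sN z2].

Definition real_analytic {R : realType} (f : R -> R) : Prop :=
  forall a : R, exists (c : nat -> R) (e : R), 0 < e /\
    forall x : R, `|x - a| < e -> pseries c (x - a) @ \oo --> f x.

Definition odd_fun {R : realType} (f : R -> R) : Prop :=
  forall z, f (- z) = - f z.
Definition even_fun {R : realType} (f : R -> R) : Prop :=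
  forall z, f (- z) = f z.

Definition trig_conditions {R : realType} (sN sD cN cD : R -> R) : Prop :=
  [/\ [/\ real_analytic sN, real_analytic sD, real_analytic cN
        & real_analytic cD],
      [/\ odd_fun sN, odd_fun sD, even_fun cN & even_fun cD],
      sN z / z @[z --> (0 : R)^'] --> (1 : R)
        /\ sD z / z @[z --> (0 : R)^'] --> (1 : R)
    & cN 0 = 1 /\ cD 0 = 1].

(* Main.v *)
(* Write mu-integration on [0, x] as a letter T and Lebesgue integration as F.
   Then p_n and q_n are alternating words in T and F applied to 1, the
   parity of n deciding the outermost letter. Self-similarity rescales a word
   on S1([0, 1]) by a factor per letter; on S2([0, 1]) it splits a word into
   its innermost letters, integrated up to the start of S2([0, 1]), and its
   outermost letters, rescaled. At x = 1 this is a convolution identity for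
   the coefficients, and the Cauchy product turns it into the system.

   For uniqueness, let D be the difference of two solutions whose Taylor
   coefficients at 0 agree below order n. Dividing the system by z ^ n and
   letting z -> 0, the n-th coefficients of D are fixed by factors smaller
   than 1 as soon as n >= 2, hence vanish; orders 0 and 1 are settled by parity
   and normalisation. So D = 0 near 0, and the system, whose right-hand sides
   only involve the contracted points z1 and z2, spreads this to all of R. *)
Require Import Defs.
From mathcomp Require Import all_boot all_order all_algebra.
From mathcomp Require Import all_classical all_reals all_analysis.
From mathcomp Require Import measurable_realfun ring lra.
Import Order.TTheory GRing.Theory Num.Theory.
Import numFieldNormedType.Exports.

Set Implicit Arguments.
Unset Strict Implicit.
Unset Printing Implicit Defensive.

Local Open Scope classical_set_scope.
Local Open Scope ring_scope.

(** * Double series and power series *)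

(** Both sides run over the pairs with i + j < N, by antidiagonals and by rows. *)
Lemma triangle_sum (V : zmodType) (F : nat -> nat -> V) (N : nat) :
  \sum_(n < N) \sum_(i < n.+1) F i (n - i)%N =
  \sum_(i < N) \sum_(j < (N - i)%N) F i j.
Proof.
elim: N => [|N IH]; first by rewrite !big_ord0.
rewrite big_ord_recr /= {}IH [RHS]big_ord_recr /= subSnn big_ord1.
rewrite [X in _ + X]big_ord_recr /= subnn addrA; congr (_ + _).
rewrite -big_split /=; apply: eq_bigr => i _.
by rewrite subSn ?big_ord_recr //= ltnW.
Qed.

Section real_series.
Context {R : realType}.
Implicit Types (u v a b : nat -> R) (F : nat -> nat -> R).

Lemma series_ord u N : series u N = \sum_(i < N) u i.
Proof. by rewrite seriesEord. Qed.

Lemma nneg_series_le_lim u N : (forall n, 0 <= u n) -> cvgn (series u) ->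
  series u N <= limn (series u).
Proof.
by move=> u0 cu; apply: nondecreasing_cvgn_le => //; exact: nondecreasing_series.
Qed.

Lemma nneg_series_cvg u (M : R) : (forall n, 0 <= u n) ->
  (forall n, series u n <= M) -> cvgn (series u).
Proof.
move=> u0 uM; apply: nondecreasing_is_cvgn; first exact: nondecreasing_series.
by exists M => _ [n _ <-].
Qed.

Section double_series.
Variable F : nat -> nat -> R.
(** Convergence of [series G] is absolute summability of the family [F], phrased through
    antidiagonals because these are the terms of Cauchy products and of binomial expansions. *)
Let G n : R := \sum_(i < n.+1) `|F i (n - i)%N|.
Hypothesis cG : cvgn (series G).

Let G_ge0 n : 0 <= G n. Proof. by apply: sumr_ge0. Qed.

Let T N : R := \sum_(i < N) \sum_(j < (N - i)%N) `|F i j|.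

Let TE N : T N = series G N.
Proof. by rewrite series_ord; exact: esym (triangle_sum (fun i j => `|F i j|) N). Qed.

Lemma double_series_row i : cvgn (series (F i)).
Proof.
apply: normed_cvg; apply: (@nneg_series_cvg _ (limn (series G))) => n /=.
  exact: normr_ge0.
rewrite series_ord.
(* The first n entries of row i lie in the triangle of size [(n + i).+1]. *)
apply: le_trans (nneg_series_le_lim (n + i).+1 G_ge0 cG).
rewrite -TE /T.
have iN : (i < (n + i).+1)%N by rewrite ltnS leq_addl.
rewrite (bigD1 (Ordinal iN)) //= -[leLHS]addr0 lerD //; last first.
  by apply: sumr_ge0 => k _; apply: sumr_ge0.
rewrite -(subnKC (_ : n <= (n + i).+1 - i)%N); last by rewrite -addSn addnK.
by rewrite big_split_ord /= lerDl; apply: sumr_ge0.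
Qed.

Let tri N : R := \sum_(i < N) \sum_(j < (N - i)%N) F i j.

(** Cut the first N rows at the edge of a larger triangle of size M. What they contain beyond the
    triangle of size N lies between the two triangles, so it is at most [series G M - series G N];
    then M tends to infinity. *)
Lemma double_series_tail N :
  `|series (fun i => limn (series (F i))) N - tri N| <= limn (series G) - series G N.
Proof.
have cv : (fun M => `|\sum_(i < N) series (F i) (M - i)%N - tri N|) @ \oo -->
          `|series (fun i => limn (series (F i))) N - tri N|.
  apply: cvg_norm; apply: cvgB; last exact: cvg_cst.
  rewrite series_ord.
  apply: cvg_big => [|i _]; first exact: add_continuous.
  by rewrite (cvg_centern i); apply: double_series_row.
rewrite -(cvg_lim _ cv) //; apply: limr_le; first by apply/cvgP: cv.
exists N => // M /= NM.
apply: (@le_trans _ _ (series G M - series G N)); last first.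
  by rewrite lerB // nneg_series_le_lim.
rewrite /tri -sumrB; apply: le_trans (ler_norm_sum _ _ _) _.
rewrite -!TE /T -(subnKC NM) big_split_ord /= addrAC -sumrB.
rewrite -[leLHS]addr0 lerD //; last by apply: sumr_ge0 => k _; apply: sumr_ge0.
apply: ler_sum => i _; rewrite series_ord.
have -> : (N + (M - N) - i = N - i + (M - N))%N by rewrite addnBAC // ltnW.
by rewrite !big_split_ord /= addrAC subrr add0r addrAC subrr add0r ler_norm_sum.
Qed.

(** Stated as a difference so that it can be used in both directions: the Cauchy product knows the
    sum by rows, the re-expansion of a power series knows the sum by antidiagonals. *)
Lemma double_series_sub0 :
  series (fun i => limn (series (F i))) -
  series (fun n => \sum_(i < n.+1) F i (n - i)%N) @ \oo --> 0.
Proof.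
have tail N := double_series_tail N.
have triE N : tri N = series (fun n => \sum_(i < n.+1) F i (n - i)%N) N.
  by rewrite series_ord (triangle_sum F).
apply/norm_cvg0P.
apply: (@squeeze_cvgr _ _ _ _ (fun=> 0) (fun N => limn (series G) - series G N)).
- by apply: nearW => N; rewrite normr_ge0 /=; have := tail N; rewrite triE.
- exact: cvg_cst.
- rewrite -[X in _ --> X](subrr (limn (series G))); apply: cvgB => //; exact: cvg_cst.
Qed.
End double_series.

End real_series.


(** * Power series: products, analyticity, leading coefficients *)

Section power_series.
Context {R : realType}.
Implicit Types (u v a b c : nat -> R).

Definition entire a := forall y : R, cvgn (pseries a y).
Definition psum a (y : R) : R := limn (pseries a y).

Lemma entire_normed a y : entire a -> cvgn [normed pseries a y].
Proof.
move=> ea; have := @is_cvg_pseries_inside_norm R a (`|y| + 1) `|y| (ea _).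
rewrite normr_id [X in _ < X]ger0_norm ?addr_ge0 // ltrDl ltr01 => /(_ isT).
suff -> : [normed pseries a y] = pseries (fun i => `|a i|) `|y| by [].
by apply/funext => n; apply: eq_bigr => i _; rewrite /= normrM normrX.
Qed.

(** The triangles of absolute values stay below the product of two absolutely convergent series, and
    each row is a multiple of the series of [b]. *)
Lemma pseries_cauchy_product a b y : entire a -> entire b ->
  pseries (fun n => \sum_(i < n.+1) a i * b (n - i)%N) y @ \oo -->
  psum a y * psum b y.
Proof.
move=> ea eb.
pose F i j := (a i * y ^+ i) * (b j * y ^+ j).
have cA := @entire_normed a y ea; have cB := @entire_normed b y eb.
have normed0 w n : 0 <= `|w n * y ^+ n| by [].
have cG : cvgn (series (fun n => \sum_(i < n.+1) `|F i (n - i)%N|)).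
  apply: (@nneg_series_cvg _ _ (limn [normed pseries a y] * limn [normed pseries b y])).
    by move=> n; apply: sumr_ge0.
  move=> N; rewrite series_ord (triangle_sum (fun i j => `|F i j|)).
  apply: (@le_trans _ _ (\sum_(i < N) `|a i * y ^+ i| * limn [normed pseries b y])).
    apply: ler_sum => i _; under eq_bigr do rewrite normrM.
    rewrite -mulr_sumr ler_wpM2l // -(series_ord (fun j => `|b j * y ^+ j|)).
    exact: (nneg_series_le_lim _ (normed0 b) cB).
  rewrite -mulr_suml ler_wpM2r //.
    apply: le_trans (nneg_series_le_lim 0 (normed0 b) cB).
    by rewrite series_ord big_ord0.
  rewrite -(series_ord (fun j => `|a j * y ^+ j|)).
  exact: (nneg_series_le_lim _ (normed0 a) cA).
have rowE : (fun i => limn (series (F i))) = (fun i => a i * y ^+ i * psum b y).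
  apply/funext => i; apply/cvg_lim => //.
  rewrite (_ : series (F i) = (a i * y ^+ i) *: pseries b y); last first.
    by rewrite -seriesZ.
  by apply: cvgZr; exact: eb.
have rows : series (fun i => limn (series (F i))) @ \oo --> psum a y * psum b y.
  rewrite rowE (_ : series _ = (fun n => pseries a y n * psum b y)); last first.
    by apply/funext => n; rewrite /pseries !series_ord mulr_suml.
  by apply: cvgMr_tmp; exact: ea.
have := cvgB rows (double_series_sub0 cG); rewrite subr0.
rewrite opprB addrC subrK.
suff -> : series (fun n => \sum_(i < n.+1) F i (n - i)%N) =
   pseries (fun n => \sum_(i < n.+1) a i * b (n - i)%N) y by apply.
congr series; apply/funext => n /=; rewrite mulr_suml; apply: eq_bigr => i _.
have <- : y ^+ i * y ^+ (n - i) = y ^+ n by rewrite -exprD subnKC // -ltnS.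
by rewrite /F mulrACA mulrACA; congr (_ * _); rewrite mulrC.
Qed.

(** Expand a_n (x0 + h)^n by the binomial theorem: the antidiagonals of [F] are the terms of the
    series at x, its rows those of the Taylor series at x0. *)
Lemma entire_analytic a : entire a -> real_analytic (psum a).
Proof.
move=> ea x0.
pose C i j : R := a (i + j)%N * 'C(i + j, i)%:R * x0 ^+ j.
exists (fun i => limn (series (C i))), 1; split => // x _.
set h := x - x0.
pose F i j := C i j * h ^+ i.
(* Used with [f] equal to [id] for the series and to [Num.norm] for its absolute values. *)
have diagE (f : R -> R) (y1 y2 : R) n : f (a n) * (y1 + y2) ^+ n =
   \sum_(i < n.+1) f (a (i + (n - i))%N) * 'C(i + (n - i), i)%:R * y1 ^+ (n - i) * y2 ^+ i.
  rewrite exprDn mulr_sumr; apply: eq_bigr => i _.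
  by rewrite subnKC -1?ltnS // -mulr_natr; ring.
have cG : cvgn (series (fun n => \sum_(i < n.+1) `|F i (n - i)%N|)).
  rewrite (_ : (fun n => _) = fun n => `|a n * (`|x0| + `|h|) ^+ n|).
    exact: entire_normed.
  apply/funext => n; rewrite normrM normrX (ger0_norm (addr_ge0 _ _)) //.
  rewrite (diagE Num.norm); apply: eq_bigr => i _.
  by rewrite /F /C !normrM !normrX normr_nat.
have rowE : (fun i => limn (series (F i))) = (fun i => limn (series (C i)) * h ^+ i).
  apply/funext => i.
  have FC : series (F i) = (fun n => series (C i) n * h ^+ i).
    by apply/funext => n; rewrite !series_ord mulr_suml.
  (* If [h ^+ i] vanishes, both sides are 0 whatever value [limn] takes on the right; otherwise row
     i of [F] can be divided by it. *)
  have [h0|h0] := eqVneq (h ^+ i) 0.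
    rewrite h0 mulr0; apply/cvg_lim => //; rewrite FC h0.
    by under eq_fun do rewrite mulr0; exact: cvg_cst.
  have cC : series (C i) @ \oo --> limn (series (F i)) * (h ^+ i)^-1.
    rewrite (_ : series (C i) = fun n => series (F i) n * (h ^+ i)^-1).
      by apply: cvgMr_tmp; exact: (@double_series_row _ F cG i).
    by apply/funext => n; rewrite FC mulfK.
  by rewrite (cvg_lim _ cC) // mulfVK.
have diag : series (fun n => \sum_(i < n.+1) F i (n - i)%N) @ \oo --> psum a x.
  rewrite (_ : series _ = pseries a x); first exact: ea.
  congr series; apply/funext => n /=.
  by rewrite (_ : x = x0 + h) ?(diagE id) // /h addrC subrK.
have := cvgD (double_series_sub0 cG) diag.
by rewrite add0r subrK rowE; apply.
Qed.

(** The first N interleaved terms consist of [uphalf N] terms of [u] and [N./2] terms of [w]. *)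
Lemma interleave_cvg u w lu lw : series u @ \oo --> lu -> series w @ \oo --> lw ->
  series (fun m => if odd m then w m./2 else u m./2) @ \oo --> lu + lw.
Proof.
move=> cu cw.
rewrite (_ : series _ = fun N => series u (uphalf N) + series w N./2); last first.
  apply/funext => N; elim: N => [|N IH].
    by rewrite !series_ord !big_ord0 addr0.
  rewrite seriesS IH -[uphalf N.+1]/(N./2.+1) -[N.+1./2]/(uphalf N) uphalf_half.
  case: (odd N) => /=.
    by rewrite !add1n [series w _.+1]seriesS; ring.
  by rewrite !add0n [series u _.+1]seriesS; ring.
have half_oo : half @ \oo --> \oo.
  by apply/cvgnyPge => A; exists A.*2 => // n /= /half_leq; rewrite doubleK.
have uphalf_oo : uphalf @ \oo --> \oo.
  by apply/cvgnyPge => A; exists A.*2 => // n /= /uphalf_leq; rewrite uphalf_double.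
by apply: cvgD; [apply: cvg_comp uphalf_oo cu|apply: cvg_comp half_oo cw].
Qed.

(** Nothing is assumed of [f] at 0, so that quotients by powers of x are allowed. With L the sum of
    |c_i| r^i for r = e / 2, the difference from c_0 is at most (L / r) |x| when |x| <= r. *)
Lemma pseries_cvg_at0 c (f : R -> R) e : 0 < e ->
  (forall x, x != 0 -> `|x| < e -> pseries c x @ \oo --> f x) ->
  f x @[x --> 0^'] --> c 0%N.
Proof.
move=> e0 cf.
have [r r0 eE] : exists2 r, 0 < r & e = 2 * r by exists (e / 2); lra.
have re : r < e by lra.
have cr : cvgn [normed pseries c r].
  (* Convergence at a point strictly between r = e / 2 and e gives absolute convergence at r. *)
  have := @is_cvg_pseries_inside_norm R c (3 / 4 * e) r.
  rewrite !gtr0_norm //; last by lra.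
  rewrite (_ : r < _ = true); last by lra.
  have -> : pseries (fun i => `|c i|) r = [normed pseries c r].
    by apply/funext => n; apply: eq_bigr => i _; rewrite /= normrM normrX (gtr0_norm r0).
  apply => //; apply/cvgP; apply: cf; first by rewrite gt_eqF //; lra.
  by rewrite gtr0_norm; lra.
set L := limn [normed pseries c r] in cr *.
have bound x : x != 0 -> `|x| <= r -> `|f x - c 0%N| <= L / r * `|x|.
  move=> x0 xr.
  have cx : (fun N => `|pseries c x N.+1 - c 0%N|) @ \oo --> `|f x - c 0%N|.
    apply: cvg_norm; apply: cvgB; last exact: cvg_cst.
    rewrite (_ : (fun N => _) = [sequence pseries c x (N + 1)%N]_N).
      by rewrite cvg_shiftn; apply: cf => //; exact: le_lt_trans re.
    by apply/funext => N; rewrite /= addn1.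
  rewrite -(cvg_lim _ cx) //; apply: limr_le; first by apply/cvgP: cx.
  apply: nearW => N; rewrite /pseries series_ord big_ord_recl /= expr0 mulr1 addrAC subrr add0r.
  apply: le_trans (ler_norm_sum _ _ _) _.
  have := nneg_series_le_lim N.+1 _ cr => /(_ (fun=> normr_ge0 _)).
  rewrite -/L series_ord big_ord_recl /= => LN.
  rewrite mulrAC ler_pdivlMr // mulr_suml.
  apply: (@le_trans _ _ (\sum_(i < N) `|c i.+1 * r ^+ i.+1| * `|x|)).
    apply: ler_sum => i _; rewrite !normrM !normrX (gtr0_norm r0) !exprS.
    rewrite -!mulrA ler_wpM2l //.
    have -> : r * (r ^+ i * `|x|) = `|x| * (r ^+ i * r) by ring.
    by rewrite ler_wpM2l // ler_wpM2r ?(ltW r0) // lerXn2r // nnegrE ltW.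
  rewrite -mulr_suml ler_wpM2r //; apply: le_trans LN.
  by rewrite lerDr.
apply: (@cvg_sub0 _ _ _ _ _ f (cst (c 0%N))); last exact: cvg_cst.
apply/norm_cvg0P.
apply: (@squeeze_cvgr _ _ _ _ (fun=> 0) (fun x => L / r * `|x|)).
- near=> x; rewrite normr_ge0 /=; apply: bound.
    by near: x; exact: nbhs_dnbhs_neq.
  by near: x; apply: dnbhs0_le.
- exact: cvg_cst.
- rewrite -[X in _ --> X](mulr0 (L / r)); apply: cvgMl_tmp.
  rewrite -[X in _ --> X](@normr0 _ R); apply: cvg_norm.
  exact: cvg_within.
Unshelve. all: by end_near. Qed.

Lemma pseries_leading c (f : R -> R) e n : 0 < e ->
  (forall x, `|x| < e -> pseries c x @ \oo --> f x) ->
  (forall m, (m < n)%N -> c m = 0) ->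
  f x / x ^+ n @[x --> 0^'] --> c n.
Proof.
move=> e0 cf c0.
have := @pseries_cvg_at0 (fun j => c (j + n)%N) (fun x => f x / x ^+ n) e e0.
apply => x x0 xe.
have := cf x xe; rewrite -(cvg_shiftn n) => /(cvgMr_tmp (b := (x ^+ n)^-1)) H.
apply: cvg_trans H; apply: near_eq_cvg; apply: nearW => N.
rewrite /pseries /= addnC !series_ord big_split_ord /= big1; last first.
  by move=> i _; rewrite c0 ?mul0r.
rewrite add0r mulr_suml; apply: eq_bigr => i _.
by rewrite [(n + i)%N]addnC exprD mulrA mulfK // expf_neq0.
Qed.
End power_series.

(** * Integration against a self-similar measure *)

Section integrals.
Context {R : realType}.
Local Notation leb := (@lebesgue_measure R).
Implicit Types (f g : R -> R).

(* A class of integrands containing all p_n and q_n, stable under integration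
   and under S1 and S2, whose members are measurable and bounded on [0, x]. *)
Definition ndnneg f := nondecreasing_fun f /\ forall x, 0 <= f x.

Lemma ndnneg_measurable f D : measurable D -> ndnneg f -> measurable_fun D f.
Proof. by move=> mD [fnd _]; exact: measurable_realfun.nondecreasing_measurable. Qed.

Lemma ndnneg_EFin_measurable f D : measurable D -> ndnneg f ->
  measurable_fun D (EFin \o f).
Proof. by move=> mD fn; apply/measurable_EFinP; exact: ndnneg_measurable. Qed.

Lemma ndnneg_S1 a f : 0 < a -> ndnneg f -> ndnneg (f \o S1 a).
Proof.
move=> a0 [fnd f0]; split=> [x y xy|x]; last exact: f0.
by apply: fnd; rewrite /S1 ler_pM2l.
Qed.

Lemma ndnneg_S2 a f : 0 < a -> ndnneg f -> ndnneg (f \o S2 a).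
Proof.
move=> a0 [fnd f0]; split=> [x y xy|x]; last exact: f0.
by apply: fnd; rewrite /S2 !lerD2r ler_pM2l.
Qed.

Lemma ndnneg_integrable (nu : {measure set (measurableTypeR R) -> \bar R}) f (x : R) :
  (nu `[0%R, x]%classic < +oo)%E -> ndnneg f ->
  nu.-integrable `[0, x]%classic (EFin \o f).
Proof.
move=> nux fn; apply: measurable_bounded_integrable => //.
  exact: ndnneg_measurable.
exists (f x); split; first exact: num_real.
move=> M fM t /=; rewrite in_itv /= => /andP[_ tx].
have [fnd f0] := fn.
by rewrite ger0_norm // (le_trans (fnd _ _ tx)) // ltW.
Qed.

Lemma ndnneg_Rintegral (nu : {measure set (measurableTypeR R) -> \bar R}) f :
  (forall x : R, nu `[0%R, x]%classic < +oo)%E -> ndnneg f ->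
  ndnneg (fun x => \int[nu]_(t in `[0, x]) f t).
Proof.
move=> nufin fn; have [_ f0] := fn.
split=> [x y xy|x]; last by apply: Rintegral_ge0 => t _.
rewrite /Rintegral; apply: fine_le.
- exact: (integrable_fin_num _ (ndnneg_integrable (nufin x) fn)).
- exact: (integrable_fin_num _ (ndnneg_integrable (nufin y) fn)).
apply: ge0_subset_integral => //.
- exact: ndnneg_EFin_measurable.
- by move=> t _; rewrite lee_fin.
- by apply: subset_itvl; rewrite bnd_simp.
Qed.

Lemma measurable_affine (a b : R) :
  measurable_fun [set: measurableTypeR R] (fun x : R => a * x + b).
Proof.
by apply: measurable_funD => //; apply: measurable_funM.
Qed.

Lemma measurable_S1 (a : R) :
  measurable_fun [set: measurableTypeR R] (S1 a : measurableTypeR R -> measurableTypeR R).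
Proof.
rewrite (_ : S1 a = fun x => a * x + 0); first exact: measurable_affine.
by apply/funext => t; rewrite addr0.
Qed.

Lemma measurable_S2 (a : R) :
  measurable_fun [set: measurableTypeR R] (S2 a : measurableTypeR R -> measurableTypeR R).
Proof.
rewrite (_ : S2 a = fun x => a * x + (1 - a)); first exact: measurable_affine.
by apply/funext => t; rewrite addrA.
Qed.

Lemma measurable_preimageT (phi : measurableTypeR R -> measurableTypeR R)
    (D : set (measurableTypeR R)) :
  measurable_fun [set: measurableTypeR R] phi -> measurable D ->
  measurable (phi @^-1` D).
Proof. by move=> mphi mD; rewrite -[X in measurable X]setTI; exact: mphi. Qed.

(** Packed as a measure, so that scaled copies can be added and integrated against. *)
Definition image_measure (nu : {measure set (measurableTypeR R) -> \bar R})
    (phi : measurableTypeR R -> measurableTypeR R)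
    (mphi : measurable_fun [set: measurableTypeR R] phi) :
    {measure set (measurableTypeR R) -> \bar R} :=
  measure_function_pushforward__canonical__measure_function_Measure nu mphi.

Lemma ge0_integral_scaled_image (nu : {measure set (measurableTypeR R) -> \bar R})
    (phi : measurableTypeR R -> measurableTypeR R)
    (mphi : measurable_fun [set: measurableTypeR R] phi) (k : {nonneg R})
    (D : set (measurableTypeR R)) f : measurable D -> ndnneg f ->
  (\int[mscale k (image_measure nu mphi)]_(t in D) (f t)%:E =
   k%:num%:E * \int[nu]_(t in phi @^-1` D) (f (phi t))%:E)%E.
Proof.
move=> mD fn; have mf := ndnneg_EFin_measurable mD fn; have [_ f0] := fn.
rewrite ge0_integral_mscale //; last by move=> t _; rewrite lee_fin.
by rewrite ge0_integral_pushforward // => t _; rewrite lee_fin.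
Qed.

(** Lebesgue measure is a times its own image under the affine map: the two agree on half-open
    intervals, hence on all Borel sets. *)
Lemma ge0_integral_lebesgue_affine (a b : R) (D : set (measurableTypeR R)) f :
  0 < a -> measurable D -> ndnneg f ->
  (\int[leb]_(t in D) (f t)%:E =
   a%:E * \int[leb]_(t in (fun x : R => a * x + b)%R @^-1` D) (f (a * t + b))%:E)%E.
Proof.
move=> a0 mD fn; have a0' : 0 <= a by exact: ltW.
rewrite -[RHS](ge0_integral_scaled_image leb (measurable_affine a b) (NngNum a0')) //.
apply: eq_measure_integral => A mA _.
apply: lebesgue_measure_unique => // X /ocitvP[->|[[x y] /= xy ->]].
  by rewrite !measure0.
change (leb `]x, y] = a%:E * leb ((fun t : R => a * t + b)%R @^-1` `]x, y]))%E.
rewrite (_ : _ @^-1` _ = `](x - b) / a, (y - b) / a]%classic); last first.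
  apply/seteqP; split => t /=; rewrite !in_itv /= ltr_pdivrMr // ler_pdivlMr //.
    by move=> /andP[? ?]; apply/andP; split; lra.
  by move=> /andP[? ?]; apply/andP; split; lra.
rewrite !lebesgue_measure_itv /= !lte_fin xy ltr_pM2r ?invr_gt0 // ltrD2r xy.
by rewrite -!EFinB -EFinM; congr EFin; field; rewrite gt_eqF.
Qed.

Lemma leb_itv_fin (x : R) : (leb `[0%R, x]%classic < +oo)%E.
Proof. by rewrite lebesgue_measure_itv /=; case: ifP; rewrite ltry. Qed.

Lemma prob_itv_fin (mu : probability (measurableTypeR R) R) (x : R) :
  (mu `[0%R, x]%classic < +oo)%E.
Proof. by apply: le_lt_trans (ltry 1); exact: probability_le1. Qed.

(** * Splitting integrals along the two similitudes *)

Section selfsimilar.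
Variables (r1 r2 m1 m2 : R) (mu : probability (measurableTypeR R) R).
Hypotheses (r1_gt0 : 0 < r1) (r2_gt0 : 0 < r2) (m1_gt0 : 0 < m1) (m2_gt0 : 0 < m2)
  (r_le1 : r1 + r2 <= 1) (m_eq1 : m1 + m2 = 1) (mu_ss : self_similar r1 r2 m1 m2 mu).

Lemma self_similar_outside (A : set (measurableTypeR R)) : measurable A ->
  A `&` `[0, 1]%classic = set0 -> mu A = 0%E.
Proof.
move=> mA A01; have [mu01 _] := mu_ss.
have mu01C : mu (~` `[0, 1]%classic) = 0%E.
  by rewrite probability_setC // mu01 subee.
apply: subset_measure0 mu01C => //; first exact: measurableC.
by apply/disjoints_subset.
Qed.

(** The preimage of 0 is 0 under [S1] and a negative point under [S2], so the mass a of 0 satisfies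
    a = m1 a, where 1 - m1 = m2 > 0. *)
Lemma self_similar_no_atom0 : mu [set 0] = 0%E.
Proof.
have key (t : R) : 0 <= t -> r2 * t + 1 - r2 = 0 -> False.
  move=> t0 H; have r2t : 0 <= r2 * t by rewrite mulr_ge0 // ltW.
  by move: r1_gt0 r_le1; lra.
have [mu01 muS] := mu_ss.
have := muS [set 0] (measurable_set1 0).
rewrite (_ : S1 r1 @^-1` [set 0] = [set 0]); last first.
  apply/seteqP; split => t /=; rewrite /S1; last by move=> ->; rewrite mulr0.
  by move/eqP; rewrite mulf_eq0 gt_eqF //= => /eqP.
rewrite [X in (_ + _ * X)%E]self_similar_outside; last 2 first.
- rewrite (_ : _ @^-1` _ = [set - (1 - r2) / r2]) //.
  apply/seteqP; split => t /=; rewrite /S2.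
    by move=> H; apply: (mulIf (lt0r_neq0 r2_gt0)); rewrite mulfVK ?lt0r_neq0 //; lra.
  by move=> ->; field; rewrite lt0r_neq0.
- apply/seteqP; split => t //= -[]; rewrite /S2 in_itv /= => H /andP[t0 t1].
  exact: (key t t0 H).
rewrite mule0 adde0.
have /fineK <- : mu [set 0] \is a fin_num by exact: fin_num_measure.
move: (fine _) => a; rewrite -EFinM => -[aE]; congr EFin.
have : m2 * a = 0.
  have <- : a - m1 * a = m2 * a by rewrite -[X in X - _]mul1r -m_eq1; ring.
  by rewrite -aE subrr.
by move/eqP; rewrite mulf_eq0 gt_eqF //= => /eqP.
Qed.

Lemma self_similar_null : mu (~` `]0, 1]%classic) = 0%E.
Proof.
have m01 : measurable (~` `[0, 1]%classic : set (measurableTypeR R)).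
  exact: measurableC.
have U0 : mu (~` `[0, 1] `|` [set 0]) = 0%E.
  apply/eqP; rewrite -measure_le0; apply: le_trans (measureU2 _ _ _) _ => //.
  rewrite [X in (_ + X)%E](_ : _ = 0%E); last exact: self_similar_no_atom0.
  rewrite [X in (X + _)%E](_ : _ = 0%E) ?adde0 //.
  by apply: self_similar_outside => //; rewrite setICl.
apply: subset_measure0 U0 => //.
- exact: measurableC.
- exact: measurableU.
- move=> t /= t01; have [->|t0] := eqVneq t 0; first by right.
  left; move: t01; rewrite !in_itv /= [0 < t]lt_neqAle eq_sym t0.
  by apply: contra_not => /andP[-> ->].
Qed.

Lemma ge0_integral_self_similar (D : set (measurableTypeR R)) f :
  measurable D -> ndnneg f ->
  (\int[mu]_(t in D) (f t)%:E =
   m1%:E * \int[mu]_(t in S1 r1 @^-1` D) (f (S1 r1 t))%:E +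
   m2%:E * \int[mu]_(t in S2 r2 @^-1` D) (f (S2 r2 t))%:E)%E.
Proof.
move=> mD fn; have [_ f0] := fn; have [_ muS] := mu_ss.
rewrite -[X in (X + _)%E](ge0_integral_scaled_image
  mu (measurable_S1 r1) (NngNum (ltW m1_gt0))) //.
rewrite -[X in (_ + X)%E](ge0_integral_scaled_image
  mu (measurable_S2 r2) (NngNum (ltW m2_gt0))) //.
rewrite -ge0_integral_measure_add //; last 2 first.
- by move=> t _; rewrite lee_fin.
- exact: ndnneg_EFin_measurable.
apply: eq_measure_integral => A mA _.
by apply: etrans (esym (measure_addE _ _ _)); exact: muS.
Qed.

(** The complement of ]0, 1] is null. This lets preimages under [S1] and [S2] be replaced by plain
    intervals or by the empty set. *)
Lemma self_similar_congr (D E : set (measurableTypeR R)) f : ndnneg f ->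
  measurable D -> measurable E ->
  (forall t, 0 < t <= 1 -> D t <-> E t) ->
  (\int[mu]_(t in D) (f t)%:E = \int[mu]_(t in E) (f t)%:E)%E.
Proof.
move=> fn mD mE DE; have [_ f0] := fn.
have mN : measurable (~` `]0, 1]%classic : set (measurableTypeR R)).
  exact: measurableC.
rewrite (ge0_negligible_integral mN mD) //; last 3 first.
- exact: ndnneg_EFin_measurable.
- by move=> t _; rewrite lee_fin.
- exact: self_similar_null.
rewrite [RHS](ge0_negligible_integral mN mE) //; last 3 first.
- exact: ndnneg_EFin_measurable.
- by move=> t _; rewrite lee_fin.
- exact: self_similar_null.
congr (integral _ _ _); rewrite !setDE setCK.
apply/seteqP; split => t [Dt t01]; split => //.
  by apply/(DE t) => //; move: t01; rewrite /= in_itv.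
by apply/(DE t) => //; move: t01; rewrite /= in_itv.
Qed.

Lemma mu_integral_left f x : ndnneg f -> 0 <= x <= 1 ->
  \int[mu]_(t in `[0, S1 r1 x]) f t = m1 * \int[mu]_(t in `[0, x]) f (S1 r1 t).
Proof.
move=> fn /andP[x0 x1].
have mp1 := measurable_preimageT (measurable_S1 r1) (measurable_itv `[0, r1 * x]).
have mp2 := measurable_preimageT (measurable_S2 r2) (measurable_itv `[0, r1 * x]).
rewrite /Rintegral ge0_integral_self_similar //.
rewrite (@self_similar_congr _ `[0, x]%classic) //; last 2 first.
- exact: (ndnneg_S1 r1_gt0 fn).
- by move=> t /andP[t0 t1]; rewrite /= !in_itv /= ler_pM2l // pmulr_rge0.
(* Strict positivity matters: if r1 + r2 = 1 and x = 1, then t = 0 satisfies the inequality, since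
   the two images touch. *)
have S2_gt (t : R) : 0 < t -> S2 r2 t <= r1 * x -> False.
  move=> /(mulr_gt0 r2_gt0) t0; rewrite /S2.
  have : r1 * x <= r1 * 1 by rewrite ler_pM2l.
  by move: t0 r_le1; lra.
rewrite (@self_similar_congr (S2 r2 @^-1` _) set0) //; last 2 first.
- exact: (ndnneg_S2 r2_gt0 fn).
- by move=> t /andP[t0 t1]; split => //; rewrite /= in_itv /= => /andP[_ /S2_gt]; exact.
rewrite integral_set0 mule0 adde0 fineM //.
exact: (integrable_fin_num _ (ndnneg_integrable (prob_itv_fin mu x) (ndnneg_S1 r1_gt0 fn))).
Qed.

(** Up to null sets, [0, S2 x] pulls back to [0, 1] under [S1] and to [0, x] under [S2]. The first
    contribution is the integral over [0, r1], by [mu_integral_left] at 1. *)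
Lemma mu_integral_right f x : ndnneg f -> 0 <= x <= 1 ->
  \int[mu]_(t in `[0, S2 r2 x]) f t =
  \int[mu]_(t in `[0, r1]) f t + m2 * \int[mu]_(t in `[0, x]) f (S2 r2 t).
Proof.
move=> fn x01.
have := mu_integral_left (x := 1) fn; rewrite ler01 lexx /S1 mulr1 => ->//.
move: x01 => /andP[x0 x1].
have mp1 := measurable_preimageT (measurable_S1 r1) (measurable_itv `[0, S2 r2 x]).
have mp2 := measurable_preimageT (measurable_S2 r2) (measurable_itv `[0, S2 r2 x]).
rewrite /Rintegral ge0_integral_self_similar //.
have r2x0 : 0 <= r2 * x by rewrite mulr_ge0 // ltW.
rewrite (@self_similar_congr _ `[0, 1]%classic) //; last 2 first.
- exact: (ndnneg_S1 r1_gt0 fn).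
- move=> t /andP[t0 t1]; rewrite /= !in_itv /= t1 (ltW t0); split => // _.
  rewrite /S1 /S2 mulr_ge0 ?(ltW r1_gt0) ?(ltW t0) //=.
  have : r1 * t <= r1 * 1 by rewrite ler_pM2l.
  by move: r2x0 r_le1; lra.
rewrite (@self_similar_congr (S2 r2 @^-1` _) `[0, x]%classic) //; last 2 first.
- exact: (ndnneg_S2 r2_gt0 fn).
- move=> t /andP[t0 t1]; rewrite /= !in_itv /= /S2 !lerD2r ler_pM2l // (ltW t0) /=.
  have -> : 0 <= r2 * t + 1 - r2 = true => //.
  have : 0 <= r2 * t by rewrite mulr_ge0 // ltW.
  by move: r1_gt0 r_le1; lra.
have fin1 := integrable_fin_num _ (ndnneg_integrable (prob_itv_fin mu 1) (ndnneg_S1 r1_gt0 fn)).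
have fin2 := integrable_fin_num _ (ndnneg_integrable (prob_itv_fin mu x) (ndnneg_S2 r2_gt0 fn)).
rewrite fineD ?fineM //.
- exact: fin2.
- exact: fin1.
- by apply: fin_numM => //; exact: fin1.
- by apply: fin_numM => //; exact: fin2.
Qed.

Lemma leb_integral_left f x : ndnneg f ->
  \int[leb]_(t in `[0, S1 r1 x]) f t = r1 * \int[leb]_(t in `[0, x]) f (S1 r1 t).
Proof.
move=> fn; rewrite /Rintegral (ge0_integral_lebesgue_affine 0 r1_gt0) //.
under [in LHS]eq_integral do rewrite addr0.
rewrite (_ : _ @^-1` _ = `[0, x]%classic); last first.
  by apply/seteqP; split => t; rewrite /= !in_itv /= addr0 ler_pM2l // pmulr_rge0.
rewrite fineM //.
exact: (integrable_fin_num _ (ndnneg_integrable (leb_itv_fin x) (ndnneg_S1 r1_gt0 fn))).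
Qed.

(** Cut the interval at r1 and 1 - r2. Unlike mu, Lebesgue measure charges the gap between these
    points, where the integrand is constant. *)
Lemma leb_integral_right f x : ndnneg f -> 0 <= x <= 1 ->
  (forall t, r1 <= t <= 1 - r2 -> f t = f r1) ->
  \int[leb]_(t in `[0, S2 r2 x]) f t =
  \int[leb]_(t in `[0, r1]) f t + (1 - (r1 + r2)) * f r1 +
  r2 * \int[leb]_(t in `[0, x]) f (S2 r2 t).
Proof.
move=> fn /andP[x0 x1] fgap; have fn2 := ndnneg_S2 r2_gt0 fn.
have S2E t : S2 r2 t = r2 * t + (1 - r2) by rewrite /S2 addrA.
have r2x0 : 0 <= r2 * x by rewrite mulr_ge0 // ltW.
rewrite S2E; set y := r2 * x + (1 - r2).
have inty := ndnneg_integrable (leb_itv_fin y) fn.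
have intg := ndnneg_integrable (leb_itv_fin (1 - r2)) fn.
have r12 : r1 <= 1 - r2 by move: r_le1; lra.
have := Rintegral_itvB (x := 1 - r2) inty.
rewrite !bnd_simp (le_trans (ltW r1_gt0) r12) /y lerDr r2x0 => /(_ isT isT).
move=> /(canRL (subrK _)) ->.
have := Rintegral_itvB (x := r1) intg.
rewrite !bnd_simp (ltW r1_gt0) r12 => /(_ isT isT).
move=> /(canRL (subrK _)) ->.
have -> : \int[leb]_(t in `]r1, 1 - r2]) f t = (1 - (r1 + r2)) * f r1.
  rewrite (@eq_Rintegral _ _ _ _ _ (cst (f r1))); last first.
    by move=> t; rewrite inE /= in_itv /= => /andP[/ltW t1 t2]; apply: fgap; rewrite t1.
  rewrite Rintegral_cst //= lebesgue_measure_itv /= lte_fin.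
  (* In the second case r1 + r2 = 1: the gap is empty and its factor is 0. *)
  case: ltP => [_|H]; first by rewrite /= mulrC; congr (_ * _); ring.
  by rewrite /= mulr0 (_ : 1 - (r1 + r2) = 0) ?mul0r //; move: r_le1 H; lra.
have -> : \int[leb]_(t in `]1 - r2, r2 * x + (1 - r2)]) f t =
    r2 * \int[leb]_(t in `[0, x]) f (S2 r2 t).
  have intx : leb.-integrable `]0, x]%classic (EFin \o (f \o S2 r2)).
    apply: integrableS (ndnneg_integrable (leb_itv_fin x) fn2) => //.
    by apply: subset_itvr; rewrite bnd_simp.
  rewrite -Rintegral_itv_obnd_cbnd //.
  rewrite /Rintegral (ge0_integral_lebesgue_affine (1 - r2) r2_gt0) //.
  under [in LHS]eq_integral do rewrite -S2E.
  rewrite (_ : _ @^-1` _ = `]0, x]%classic); last first.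
    by apply/seteqP; split => t; rewrite /= !in_itv /= lerD2r ltrDr ler_pM2l // pmulr_rgt0.
  by rewrite fineM //; exact: (integrable_fin_num _ intx).
by ring.
Qed.

End selfsimilar.
End integrals.

(** * Alternating iterated integrals *)

Section words.
Context {R : realType}.
Local Notation leb := (@lebesgue_measure R).

Lemma Rintegral_exprn (n : nat) (x : R) : 0 <= x ->
  \int[leb]_(t in `[0, x]) t ^+ n = x ^+ n.+1 / n.+1%:R.
Proof.
rewrite le_eqVlt => /predU1P[<-|x0].
  by rewrite set_itv1 Rintegral_set1 expr0n mul0r.
pose F (t : R) := t ^+ n.+1 * n.+1%:R^-1.
have cF : continuous F.
  by move=> t; apply: cvgM; [exact: exprn_continuous|exact: cvg_cst].
rewrite /Rintegral (@continuous_FTC2 _ _ F) //.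
- by rewrite /F /= expr0n /= mul0r subr0.
- by apply: continuous_subspaceT; exact: exprn_continuous.
- split.
  + by move=> t _; apply: derivableM => //; exact: exprn_derivable.
  + exact: cvg_at_right_filter (cF 0).
  + exact: cvg_at_left_filter (cF x).
- move=> t _; rewrite derive1Mr; last exact: exprn_derivable.
  by rewrite exp_derive1 /= [_ *: _]mulrC mulfK // pnatr_eq0.
Qed.

Variable mu : probability (measurableTypeR R) R.

Definition iint (c : bool) (f : R -> R) (x : R) : R :=
  if c then \int[mu]_(t in `[0, x]) f t else \int[leb]_(t in `[0, x]) f t.

(* [word c n] is an alternating word of n letters; [c] is the outermost letter
   ([true]: integrate against mu; [false]: against Lebesgue measure). *)
Fixpoint word (c : bool) (n : nat) : R -> R :=
  if n is k.+1 then iint c (word (~~ c) k) else fun=> 1.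

Lemma pfun_word n : pfun mu n = word (odd n) n.
Proof. by elim: n => // n IH; apply/funext => x /=; rewrite IH negbK. Qed.

Lemma qfun_word n : qfun mu n = word (~~ odd n) n.
Proof.
elim: n => // n IH; apply/funext => x /=; rewrite IH negbK /iint.
by case: (odd n).
Qed.

Lemma iint_ndnneg c f : ndnneg f -> ndnneg (iint c f).
Proof.
by case: c => fn; apply: ndnneg_Rintegral => // x; [exact: prob_itv_fin|exact: leb_itv_fin].
Qed.

Lemma word_ndnneg c n : ndnneg (word c n).
Proof.
by elim: n c => [c|n IH c] /=; [split => // x; rewrite ler01|exact: iint_ndnneg].
Qed.

Lemma eq_iint c f g x : (forall t, 0 <= t <= x -> f t = g t) ->
  iint c f x = iint c g x.
Proof.
move=> fg; have E : {in `[0, x]%classic, f =1 g}.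
  by move=> t; rewrite inE /= in_itv /=; exact: fg.
by case: c; exact: eq_Rintegral.
Qed.

Lemma ndnneg_comb_integrable (nu : {measure set (measurableTypeR R) -> \bar R})
    n (a : nat -> R) (F : nat -> R -> R) x :
  (nu `[0%R, x]%classic < +oo)%E -> (forall i, ndnneg (F i)) ->
  nu.-integrable `[0, x]%classic (fun t => (\sum_(i < n) a i * F i t)%:E).
Proof.
move=> nux Fn.
rewrite (_ : (fun t => _) = fun t => (\sum_(i < n) (a i)%:E * (F i t)%:E)%E).
  apply: integrable_sum => // i _.
  by apply: integrableZl => //; exact: ndnneg_integrable.
by apply/funext => t; rewrite -sumEFin; under eq_bigr do rewrite EFinM.
Qed.

Lemma ndnneg_comb_Rintegral (nu : {measure set (measurableTypeR R) -> \bar R})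
    n (a : nat -> R) (F : nat -> R -> R) x :
  (nu `[0%R, x]%classic < +oo)%E -> (forall i, ndnneg (F i)) ->
  \int[nu]_(t in `[0, x]) (\sum_(i < n) a i * F i t) =
  \sum_(i < n) a i * \int[nu]_(t in `[0, x]) F i t.
Proof.
move=> nux Fn; elim: n => [|n IH].
  under eq_Rintegral do rewrite big_ord0.
  by rewrite Rintegral_cst // mul0r big_ord0.
under eq_Rintegral do rewrite big_ord_recr.
have intF := ndnneg_integrable nux (Fn n).
rewrite big_ord_recr /= RintegralD //; last 2 first.
- exact: ndnneg_comb_integrable.
- rewrite (_ : EFin \o _ = fun t => ((a n)%:E * (F n t)%:E)%E) //.
  exact: integrableZl.
by rewrite IH RintegralZl.
Qed.

Lemma iint_comb c n (a : nat -> R) (F : nat -> R -> R) x :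
  (forall i, ndnneg (F i)) ->
  iint c (fun t => \sum_(i < n) a i * F i t) x = \sum_(i < n) a i * iint c (F i) x.
Proof.
move=> Fn; rewrite /iint; case: c; apply: ndnneg_comb_Rintegral => //.
- exact: prob_itv_fin.
- exact: leb_itv_fin.
Qed.

(** On [0, x] the integrand is at most f x, and mu has mass at most 1. *)
Lemma iint_true_le f x : ndnneg f -> iint true f x <= f x.
Proof.
move=> fn; have [fnd f0] := fn.
apply: (@le_trans _ _ (\int[mu]_(t in `[0, x]) f x)).
  apply: le_Rintegral => //.
  - exact: ndnneg_integrable (prob_itv_fin mu x) fn.
  - apply: (ndnneg_integrable (prob_itv_fin mu x) (f := fun=> f x)).
    by split => // t _; exact: f0.
  - by move=> t /=; rewrite in_itv /= => /andP[_ /fnd].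
rewrite Rintegral_cst // -[leRHS]mulr1 ler_wpM2l //.
by rewrite -lee_fin fineK ?probability_le1 // fin_num_measure.
Qed.

(* The exponent counts the Lebesgue letters of the word. *)
Lemma word_le c n x : 0 <= x ->
  word c n x <= x ^+ (if c then n./2 else uphalf n) / (if c then n./2 else uphalf n)`!%:R.
Proof.
elim: n c x => [|n IH] c x x0; first by case: c; rewrite /= divr1.
case: c => /=.
  by apply: le_trans (iint_true_le _ (word_ndnneg _ _)) _; exact: IH.
pose k := n./2; rewrite -/k.
(* [ndnneg] asks for monotonicity on the whole line, so the power is truncated at 0. The one-term
   sum gives the shape that [iint_comb] expects. *)
pose p t : R := \sum_(i < 1) (k`!%:R^-1) * (Num.max 0 t) ^+ k.
have maxn : ndnneg (fun t : R => Num.max 0 t ^+ k).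
  split=> [y z yz|y]; last by apply: exprn_ge0; rewrite le_max lexx.
  apply: lerXn2r; [by rewrite nnegrE le_max lexx|by rewrite nnegrE le_max lexx|].
  by rewrite ge_max !le_max lexx yz orbT.
apply: (@le_trans _ _ (iint false p x)).
  apply: le_Rintegral => //.
  - exact: ndnneg_integrable (leb_itv_fin x) (word_ndnneg _ _).
  - exact: (@ndnneg_comb_integrable leb 1 (fun=> k`!%:R^-1) _ x (leb_itv_fin x) (fun=> maxn)).
  - move=> t /=; rewrite in_itv /= => /andP[t0 _].
    rewrite /p big_ord1 (max_idPr t0) mulrC; exact: (IH true).
rewrite (@iint_comb false 1 (fun=> k`!%:R^-1) (fun=> fun t : R => Num.max 0 t ^+ k)) //.
rewrite big_ord1 (@eq_iint _ _ (fun t => t ^+ k)); last first.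
  by move=> t /andP[t0 _]; rewrite (max_idPr t0).
rewrite /iint Rintegral_exprn // factS natrM invfM mulrCA.
by rewrite [k`!%:R^-1 / _]mulrC.
Qed.

(** * Words on the images of the two similitudes *)

Section selfsimilar.
Variables (r1 r2 m1 m2 : R).
Hypotheses (r1_gt0 : 0 < r1) (r2_gt0 : 0 < r2) (m1_gt0 : 0 < m1) (m2_gt0 : 0 < m2)
  (r_le1 : r1 + r2 <= 1) (m_eq1 : m1 + m2 = 1) (mu_ss : self_similar r1 r2 m1 m2 mu).

Fixpoint weight (r m : R) (c : bool) (n : nat) : R :=
  if n is k.+1 then (if c then m else r) * weight r m (~~ c) k else 1.

(* The value of [word c n] at 1 - r2 = S2(0): mu does not charge the gap between
   the images of S1 and S2, so only an outermost Lebesgue letter sees it. *)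
Definition gapword c n : R :=
  weight r1 m1 c n * word c n 1 +
  if c then 0 else
    if n is k.+1 then (1 - (r1 + r2)) * (weight r1 m1 true k * word true k 1) else 0.

Lemma word_left c n x : 0 <= x <= 1 ->
  word c n (S1 r1 x) = weight r1 m1 c n * word c n x.
Proof.
elim: n c x => [|n IH] c x x01; first by rewrite mul1r.
(* A sum with one term, so that [iint_comb] pulls out the scalar. *)
have IH' t : 0 <= t <= x -> word (~~ c) n (S1 r1 t) =
    \sum_(i < 1) weight r1 m1 (~~ c) n * word (~~ c) n t.
  move: x01 => /andP[x0 x1] /andP[t0 tx]; rewrite big_ord1 IH //.
  by rewrite t0 (le_trans tx).
have E : iint c (fun t => word (~~ c) n (S1 r1 t)) x =
    weight r1 m1 (~~ c) n * word c n.+1 x.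
  rewrite (eq_iint c IH') (@iint_comb c 1 (fun=> weight r1 m1 (~~ c) n) (fun=> word (~~ c) n)).
    by rewrite big_ord1.
  by move=> _; exact: word_ndnneg.
rewrite [RHS]/= -mulrA -[iint c _ x]/(word c n.+1 x) -E /=.
case: c {IH IH' E} => /=.
- by rewrite (mu_integral_left r1_gt0 r2_gt0 m1_gt0 m2_gt0 r_le1 m_eq1 mu_ss (word_ndnneg _ _)).
- by rewrite (leb_integral_left r1_gt0 _ (word_ndnneg _ _)).
Qed.

(** By monotonicity it suffices to compare the ends of the gap. As 1 - r2 = S2(0),
    [mu_integral_right] at 0 gives their difference as a multiple of an integral over the null set
    {0}. *)
Lemma word_gap n t : r1 <= t <= 1 - r2 -> word true n t = word true n r1.
Proof.
case: n => // n /andP[t1 t2].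
have [wnd _] := word_ndnneg true n.+1.
apply/eqP; rewrite eq_le (wnd _ _ t1) andbT; apply: le_trans (wnd _ _ t2) _.
have := mu_integral_right r1_gt0 r2_gt0 m1_gt0 m2_gt0 r_le1 m_eq1 mu_ss
  (x := 0) (word_ndnneg false n).
rewrite lexx ler01 => /(_ isT).
rewrite {1}/S2 mulr0 add0r [word true _ _]/= => ->.
rewrite [X in _ + _ * X](_ : _ = 0) ?mulr0 ?addr0 //.
rewrite /Rintegral (self_similar_congr (E := set0) r1_gt0 r2_gt0 m2_gt0 r_le1 m_eq1 mu_ss) //.
- by rewrite integral_set0.
- exact: ndnneg_S2 r2_gt0 (word_ndnneg false n).
- move=> s /andP[s0 _]; rewrite /= in_itv /=; split => // /andP[_ s0'].
  by move: s0; rewrite ltNge s0'.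
Qed.

(** The index i counts the outermost letters integrated inside the image of [S2]. The n - i inner
    letters stop at S2(0) and contribute a [gapword], whose own outermost letter is c flipped i
    times. *)
Lemma word_right c n x : 0 <= x <= 1 ->
  word c n (S2 r2 x) =
  \sum_(i < n.+1) gapword (c (+) odd i) (n - i) * weight r2 m2 c i * word c i x.
Proof.
elim: n c x => [|n IH] c x x01.
  by rewrite big_ord1 /= /gapword /= addbF; case: c; rewrite !mulr1 addr0.
(* Only the outermost integral is split, at S2(0); the induction hypothesis then expands the
   integrand on the image of [S2]. *)
have split_int : word c n.+1 (S2 r2 x) = gapword c n.+1 +
   (if c then m2 else r2) * iint c (fun t => word (~~ c) n (S2 r2 t)) x.
  have := word_left c n.+1 (x := 1); rewrite ler01 lexx /S1 mulr1 => /(_ isT) w1.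
  rewrite /gapword -w1; case: c {w1} => /=.
    by rewrite addr0 (mu_integral_right r1_gt0 r2_gt0 m1_gt0 m2_gt0 r_le1 m_eq1 mu_ss
      (word_ndnneg _ _)).
  rewrite (leb_integral_right r1_gt0 r2_gt0 r_le1 (word_ndnneg _ _) x01); last first.
    exact: word_gap.
  by have := word_left true n (x := 1); rewrite ler01 lexx /S1 mulr1 => ->.
rewrite split_int big_ord_recl /= addbF subn0 !mulr1; congr (_ + _).
rewrite (@eq_iint c _ (fun t => \sum_(i < n.+1)
   (gapword (~~ c (+) odd i) (n - i) * weight r2 m2 (~~ c) i) * word (~~ c) i t)); last first.
  move: x01 => /andP[x0 x1] t /andP[t0 tx].
  by apply: IH; rewrite t0 (le_trans tx).
rewrite (@iint_comb c n.+1 (fun i => gapword (~~ c (+) odd i) (n - i) * weight r2 m2 (~~ c) i)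
  (word (~~ c))); last by move=> i; exact: word_ndnneg.
rewrite mulr_sumr; apply: eq_bigr => i _.
by rewrite /bump /= add1n subSS /= addNb addbN mulrA mulrCA.
Qed.

(** [word_right] at x = 1, the fixed point of [S2]. *)
Lemma word1_rec c n : word c n 1 =
  \sum_(i < n.+1) gapword (c (+) odd i) (n - i) * (weight r2 m2 c i * word c i 1).
Proof.
have := @word_right c n 1; rewrite ler01 lexx => /(_ isT).
rewrite {1}/S2 mulr1 addrC addKr => ->.
by apply: eq_bigr => i _; rewrite mulrA.
Qed.

End selfsimilar.
End words.

(** * The generating functions *)

Lemma sum_double (V : zmodType) (F : nat -> V) (n : nat) :
  \sum_(i < n.*2) F i = \sum_(k < n) F k.*2 + \sum_(k < n) F k.*2.+1.
Proof.
elim: n => [|n IH]; first by rewrite !big_ord0 addr0.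
by rewrite doubleS !big_ord_recr /= IH -!addrA; congr (_ + _); rewrite addrCA.
Qed.

Section power_series_algebra.
Context {R : realType}.
Implicit Types (a b : nat -> R) (y : R).

Lemma entire_le_fact a : (forall n, `|a n| <= n`!%:R^-1) -> entire a.
Proof.
move=> ale y; apply: normed_cvg.
apply: (@series_le_cvg _ _ (exp_coeff `|y|)).
- by move=> n; apply: normr_ge0.
- by move=> n; apply: exp_coeff_ge0.
- by move=> n; rewrite /= normrM normrX /exp_coeff /= mulrC ler_wpM2l.
- exact: is_cvg_series_exp_coeff.
Qed.

Lemma pseriesD_cvg a b y la lb : pseries a y @ \oo --> la ->
  pseries b y @ \oo --> lb -> pseries (fun n => a n + b n) y @ \oo --> la + lb.
Proof.
move=> ca cb; rewrite (_ : pseries _ y = pseries a y + pseries b y); first exact: cvgD.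
apply/funext => N; rewrite -[RHS]/(pseries a y N + pseries b y N) /pseries !series_ord -big_split /=.
by apply: eq_bigr => i _; rewrite mulrDl.
Qed.

Lemma pseriesZ_cvg k a y l : pseries a y @ \oo --> l ->
  pseries (fun n => k * a n) y @ \oo --> k * l.
Proof.
move=> ca; rewrite (_ : pseries _ y = fun N => k * pseries a y N); first exact: cvgMl_tmp.
apply/funext => N; rewrite /pseries !series_ord mulr_sumr.
by apply: eq_bigr => i _; rewrite mulrA.
Qed.

Definition shift_seq a n : R := if n is k.+1 then a k else 0.

Lemma pseries_shift_cvg a y l : pseries a y @ \oo --> l ->
  pseries (shift_seq a) y @ \oo --> y * l.
Proof.
move=> ca; rewrite -(cvg_shiftn 1).
rewrite (_ : [sequence _]_n = fun N => y * pseries a y N); first exact: cvgMl_tmp.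
apply/funext => N; rewrite /= addn1 /pseries !series_ord big_ord_recl /= mul0r add0r mulr_sumr.
by apply: eq_bigr => i _; rewrite /= exprS mulrCA.
Qed.

Lemma pseries_dilate a t y : pseries (fun n => t ^+ n * a n) y = pseries a (t * y).
Proof.
apply/funext => N; rewrite /pseries !series_ord; apply: eq_bigr => i _.
by rewrite /= exprMn mulrAC mulrC.
Qed.

End power_series_algebra.

Section system.
Context {R : realType} (mu : probability (measurableTypeR R) R).

(** Even and odd lengths get separate power series in y. At y = -z^2 they give the cosines, and the
    sines divided by z; signs are absorbed and the dilation factors are r1 m1 and r2 m2, free of
    square roots. *)
Definition even_word c k : R := word mu c k.*2 1.
Definition odd_word c k : R := word mu c k.*2.+1 1.

Lemma even_word_entire c : entire (even_word c).
Proof.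
apply: entire_le_fact => n; have [_ w0] := word_ndnneg mu c n.*2.
rewrite /even_word ger0_norm //. apply: le_trans (word_le mu c n.*2 ler01) _.
by rewrite expr1n mul1r doubleK uphalf_double; case: c {w0}.
Qed.

Lemma odd_word_entire c : entire (odd_word c).
Proof.
apply: entire_le_fact => n; have [_ w0] := word_ndnneg mu c n.*2.+1.
rewrite /odd_word ger0_norm //; apply: le_trans (word_le mu c n.*2.+1 ler01) _.
rewrite expr1n mul1r /= uphalf_double doubleK; case: c {w0} => //.
by rewrite lef_pV2 ?posrE ?ltr0n ?fact_gt0 // ler_nat factS leq_pmull.
Qed.

(** Two consecutive letters always contribute one factor r and one factor m. *)
Lemma weight_double r m c n : weight r m c n.*2 = (r * m) ^+ n :> R.
Proof.
elim: n => // n IH; rewrite doubleS /= negbK IH exprS mulrA.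
by case: c {IH}; rewrite /= // [m * r]mulrC.
Qed.

Lemma weight_doubleS r m c n :
  weight r m c n.*2.+1 = (r * m) ^+ n * (if c then m else r) :> R.
Proof. by rewrite /= weight_double mulrC. Qed.

Variables (r1 r2 m1 m2 : R).
Hypotheses (r1_gt0 : 0 < r1) (r2_gt0 : 0 < r2) (m1_gt0 : 0 < m1) (m2_gt0 : 0 < m2)
  (r_le1 : r1 + r2 <= 1) (m_eq1 : m1 + m2 = 1) (mu_ss : self_similar r1 r2 m1 m2 mu).

Local Notation delta := (1 - (r1 + r2)).
Local Notation E c := (psum (even_word c)).
Local Notation O c := (psum (odd_word c)).
Local Notation gap := (gapword mu r1 r2 m1).

(** [gap_even] and [gap_odd] are the generating functions of [gapword] at even and odd lengths.
    Crossing the gap uses up one Lebesgue letter; from an even length this leaves an odd word of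
    smaller index, whence the extra factor y. *)
Definition gap_even c y : R :=
  E c (r1 * m1 * y) + (if c then 0 else delta * (y * (m1 * O true (r1 * m1 * y)))).
Definition gap_odd c y : R :=
  (if c then m1 else r1) * O c (r1 * m1 * y) +
  (if c then 0 else delta * E true (r1 * m1 * y)).

Lemma even_dilate_cvg t c y :
  pseries (fun n => t ^+ n * even_word c n) y @ \oo --> E c (t * y).
Proof. by rewrite pseries_dilate; exact: even_word_entire. Qed.

Lemma odd_dilate_cvg t k c y :
  pseries (fun n => k * (t ^+ n * odd_word c n)) y @ \oo --> k * O c (t * y).
Proof. by apply: pseriesZ_cvg; rewrite pseries_dilate; exact: odd_word_entire. Qed.

Lemma gap_even_cvg c y : pseries (fun n => gap c n.*2) y @ \oo --> gap_even c y.
Proof.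
rewrite (_ : (fun n => _) = fun n => (r1 * m1) ^+ n * even_word c n +
   (if c then 0 else delta *
     shift_seq (fun k => m1 * ((r1 * m1) ^+ k * odd_word true k)) n)); last first.
  apply/funext => n; rewrite /gapword weight_double; congr (_ + _).
  case: c => //; case: n => [|n]; first by rewrite mulr0.
  by rewrite doubleS [in RHS]/shift_seq weight_doubleS [_ * m1]mulrC !mulrA.
apply: pseriesD_cvg; first exact: even_dilate_cvg.
(* For c = [true] the second summand is the zero series, obtained as 0 times a convergent one. *)
case: c.
  have := @pseriesZ_cvg _ 0 _ y _ (@even_word_entire true y).
  rewrite mul0r; apply: cvg_trans; apply: near_eq_cvg; apply: nearW => N.
  by congr (pseries _ _ _); apply/funext => n; rewrite mul0r.
by apply: pseriesZ_cvg; apply: pseries_shift_cvg; exact: odd_dilate_cvg.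
Qed.

Lemma gap_odd_cvg c y : pseries (fun n => gap c n.*2.+1) y @ \oo --> gap_odd c y.
Proof.
rewrite (_ : (fun n => _) = fun n =>
   (if c then m1 else r1) * ((r1 * m1) ^+ n * odd_word c n) +
   (if c then 0 else delta * ((r1 * m1) ^+ n * even_word true n))); last first.
  apply/funext => n; rewrite /gapword weight_doubleS weight_double; congr (_ + _).
  by rewrite -mulrA mulrCA.
apply: pseriesD_cvg; first exact: odd_dilate_cvg.
case: c.
  have := @pseriesZ_cvg _ 0 _ y _ (@even_word_entire true y).
  rewrite mul0r; apply: cvg_trans; apply: near_eq_cvg; apply: nearW => N.
  by congr (pseries _ _ _); apply/funext => n; rewrite mul0r.
by apply: pseriesZ_cvg; exact: even_dilate_cvg.
Qed.

Lemma product_cvg (a b : nat -> R) (fa fb : R -> R) y :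
  (forall y, pseries a y @ \oo --> fa y) -> (forall y, pseries b y @ \oo --> fb y) ->
  pseries (fun n => \sum_(i < n.+1) a i * b (n - i)%N) y @ \oo --> fa y * fb y.
Proof.
move=> ca cb.
have ea : entire a by move=> z; apply/cvgP; exact: ca.
have eb : entire b by move=> z; apply/cvgP; exact: cb.
have := @pseries_cauchy_product R a b y ea eb.
by rewrite /psum (cvg_lim _ (ca y)) // (cvg_lim _ (cb y)).
Qed.

(** Sort the terms of [word1_rec] at length 2n by the parity of i. Even i gives a Cauchy product of
    even parts; odd i pairs two odd lengths, whose indices add up to n - 1, hence the factor y. *)
Lemma even_wordE c y : E c y =
  E c (r2 * m2 * y) * gap_even c y +
  y * ((if c then m2 else r2) * O c (r2 * m2 * y) * gap_odd (~~ c) y).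
Proof.
have pe := @product_cvg _ _ _ _ y (@even_dilate_cvg (r2 * m2) c) (@gap_even_cvg c).
have po := @product_cvg _ _ _ _ y
  (@odd_dilate_cvg (r2 * m2) (if c then m2 else r2) c) (@gap_odd_cvg (~~ c)).
have := pseriesD_cvg pe (pseries_shift_cvg po).
rewrite [X in X @ _ --> _](_ : _ = pseries (even_word c) y); first by move=> H; apply: cvg_lim.
congr (pseries _ y); apply/funext => n; apply/esym.
rewrite /even_word (word1_rec r1_gt0 r2_gt0 m1_gt0 m2_gt0 r_le1 m_eq1 mu_ss).
(* There are 2n + 1 terms: the last one is set aside before splitting by parity, then returned to
   the even sum. The odd sum is empty for n = 0, matching the leading 0 of [shift_seq]. *)
rewrite big_ord_recr /=.
rewrite (sum_double (fun i => gap (c (+) odd i) (n.*2 - i) *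
  (weight r2 m2 c i * word mu c i 1))) addrAC; congr (_ + _).
  rewrite big_ord_recr /=; congr (_ + _); last first.
    by rewrite odd_double addbF !subnn weight_double mulrC.
  apply: eq_bigr => i _; rewrite odd_double addbF weight_double mulrC -doubleB.
  by [].
case: n => [|n]; first by rewrite big_ord0.
apply: eq_bigr => i _; rewrite /= odd_double /= addbT weight_double.
rewrite doubleS subSS subSn ?leq_double -1?ltnS // -doubleB.
by rewrite mulrC !mulrA.
Qed.

(** At length 2n + 1 there are 2n + 2 terms, so both parities give full Cauchy products of index n
    and no factor y appears. *)
Lemma odd_wordE c y : O c y =
  E c (r2 * m2 * y) * gap_odd c y +
  (if c then m2 else r2) * O c (r2 * m2 * y) * gap_even (~~ c) y.
Proof.
have pe := @product_cvg _ _ _ _ y (@even_dilate_cvg (r2 * m2) c) (@gap_odd_cvg c).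
have po := @product_cvg _ _ _ _ y
  (@odd_dilate_cvg (r2 * m2) (if c then m2 else r2) c) (@gap_even_cvg (~~ c)).
have := pseriesD_cvg pe po.
rewrite [X in X @ _ --> _](_ : _ = pseries (odd_word c) y); first by move=> H; apply: cvg_lim.
congr (pseries _ y); apply/funext => n; apply/esym.
rewrite /odd_word (word1_rec r1_gt0 r2_gt0 m1_gt0 m2_gt0 r_le1 m_eq1 mu_ss).
rewrite -doubleS.
rewrite (sum_double (fun i => gap (c (+) odd i) (n.*2.+1 - i) *
  (weight r2 m2 c i * word mu c i 1))); congr (_ + _); apply: eq_bigr => i _.
  rewrite odd_double addbF weight_double mulrC subSn ?leq_double -1?ltnS // -doubleB.
  by [].
rewrite /= odd_double /= addbT weight_double subSS -doubleB.
by rewrite mulrC !mulrA.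
Qed.

End system.

(** * Uniqueness *)

Section analytic_at0.
Context {R : realType}.
Implicit Types (f g : R -> R) (c : nat -> R).

Definition expansion0 c f :=
  exists2 e : R, 0 < e & forall x, `|x| < e -> pseries c x @ \oo --> f x.

Lemma real_analytic_expansion0 f : real_analytic f -> exists c, expansion0 c f.
Proof.
move=> /(_ 0)[c [e [e0 cf]]]; exists c, e => // x xe.
by have := cf x; rewrite subr0; apply.
Qed.

Lemma expansion0B c d f g : expansion0 c f -> expansion0 d g ->
  expansion0 (fun n => c n - d n) (fun x => f x - g x).
Proof.
move=> [e e0 cf] [e' e'0 dg]; exists (Num.min e e'); first by rewrite lt_min e0.
move=> x; rewrite lt_min => /andP[xe xe'].
rewrite (_ : pseries _ x = pseries c x - pseries d x).
  by apply: cvgB; [exact: cf|exact: dg].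
apply/funext => N; rewrite -[RHS]/(pseries c x N - pseries d x N) /pseries !series_ord.
by rewrite -sumrB; apply: eq_bigr => i _; rewrite /= mulrBl.
Qed.

Lemma pseries_at0_cvg c : pseries c 0 @ \oo --> c 0%N.
Proof.
rewrite -(cvg_shiftn 1) (_ : [sequence _]_n = cst (c 0%N)); first exact: cvg_cst.
apply/funext => N; rewrite /= addn1 /pseries series_ord big_ord_recl /= expr0 mulr1.
by rewrite big1 ?addr0 // => i _; rewrite expr0n mulr0.
Qed.

Lemma expansion0_at0 c f : expansion0 c f -> f 0 = c 0%N.
Proof.
move=> [e e0 cf]; apply: (@cvg_unique _ _ (pseries c 0 @ \oo)) => //.
  by apply: cf; rewrite normr0.
exact: pseries_at0_cvg.
Qed.

Lemma expansion0_leading c f n : expansion0 c f -> (forall m, (m < n)%N -> c m = 0) ->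
  f x / x ^+ n @[x --> 0^'] --> c n.
Proof. by move=> [e e0 cf]; exact: pseries_leading cf. Qed.

Lemma expansion0_cvg c f : expansion0 c f -> f x @[x --> 0^'] --> f 0.
Proof.
move=> cf; rewrite (expansion0_at0 cf).
have c0 m : (m < 0)%N -> c m = 0 by [].
have := expansion0_leading cf c0; apply: cvg_trans.
by apply: near_eq_cvg; apply: nearW => x; rewrite expr0 divr1.
Qed.

Lemma cvg_dilate (a : R) : a != 0 -> (a * x) @[x --> (0 : R)^'] --> (0 : R)^'.
Proof.
move=> a0 A [e /= e0 eA]; exists (e / `|a|); first by rewrite /= divr_gt0 ?normr_gt0.
move=> x /=; rewrite sub0r normrN ltr_pdivlMr ?normr_gt0 // => xe x0.
by apply: eA; rewrite /= ?mulf_neq0 // sub0r normrN normrM mulrC.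
Qed.

Lemma cvg_ratio_dilate f n (a l : R) : a != 0 ->
  f x / x ^+ n @[x --> 0^'] --> l -> f (a * x) / x ^+ n @[x --> 0^'] --> a ^+ n * l.
Proof.
move=> a0 fl.
have H : a ^+ n * (f (a * x) / (a * x) ^+ n) @[x --> 0^'] --> a ^+ n * l.
  by apply: cvgMl_tmp; exact: cvg_comp (cvg_dilate a0) fl.
apply: cvg_trans H; apply: near_eq_cvg; apply: nearW => x /=.
by rewrite exprMn invfM mulrCA mulVKf ?expf_neq0.
Qed.

(** Primes mark a second solution, not derivatives. The limit comes from writing f g - f' g' as (f -
    f') g + f' (g - g'). *)
Lemma cvg_ratio_product f f' g g' n (a b d d' f0 g0 : R) : a != 0 -> b != 0 ->
  (f x - f' x) / x ^+ n @[x --> 0^'] --> d ->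
  (g x - g' x) / x ^+ n @[x --> 0^'] --> d' ->
  f' x @[x --> 0^'] --> f0 -> g x @[x --> 0^'] --> g0 ->
  (f (a * x) * g (b * x) - f' (a * x) * g' (b * x)) / x ^+ n @[x --> 0^'] -->
  a ^+ n * d * g0 + f0 * (b ^+ n * d').
Proof.
move=> a0 b0 fd gd f'0 gg0.
have c1 : (f (a * x) - f' (a * x)) / x ^+ n * g (b * x) @[x --> 0^'] -->
    a ^+ n * d * g0.
  apply: cvgM; first exact: (cvg_ratio_dilate (f := fun x => f x - f' x) a0 fd).
  exact: cvg_comp (cvg_dilate b0) gg0.
have c2 : f' (a * x) * ((g (b * x) - g' (b * x)) / x ^+ n) @[x --> 0^'] -->
    f0 * (b ^+ n * d').
  apply: cvgM; last exact: (cvg_ratio_dilate (f := fun x => g x - g' x) b0 gd).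
  exact: cvg_comp (cvg_dilate a0) f'0.
have c12 : (f (a * x) - f' (a * x)) / x ^+ n * g (b * x) +
    f' (a * x) * ((g (b * x) - g' (b * x)) / x ^+ n) @[x --> 0^'] -->
    a ^+ n * d * g0 + f0 * (b ^+ n * d') by exact: cvgD c1 c2.
apply: cvg_trans c12.
by apply: near_eq_cvg; apply: nearW => x /=; ring.
Qed.

(** The shape of each equation of the system, subtracted for two solutions and divided by z^n. The
    gap term carries a further factor z and disappears in the limit. *)
Lemma cvg_linear_system (D X Y Z : R -> R) n (l x y w : R) :
  D z / z ^+ n @[z --> 0^'] --> l ->
  X z @[z --> 0^'] --> x -> Y z @[z --> 0^'] --> y -> Z z @[z --> 0^'] --> w ->
  forall a b k : R,
  (forall z, z != 0 -> D z / z ^+ n = a * X z + b * Y z + k * z * Z z) ->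
  l = a * x + b * y.
Proof.
move=> Dl Xx Yy Zw a b k DE.
have id0 : z @[z --> (0 : R)^'] --> (0 : R) by exact: cvg_within.
have H : a * X z + b * Y z + k * z * Z z @[z --> 0^'] --> a * x + b * y + k * 0 * w.
  apply: cvgD; first by apply: cvgD; apply: cvgMl_tmp.
  by apply: cvgM => //; apply: cvgMl_tmp.
rewrite mulr0 mul0r addr0 in H.
suff H' : D z / z ^+ n @[z --> 0^'] --> a * x + b * y by exact: (cvg_unique _ Dl H').
apply: cvg_trans H; apply: near_eq_cvg.
by near=> z; apply/esym/DE; near: z; exact: nbhs_dnbhs_neq.
Unshelve. all: by end_near. Qed.

Lemma expansion0_eq0 c f : expansion0 c f -> (forall n, c n = 0) ->
  exists2 e : R, 0 < e & forall x, `|x| < e -> f x = 0.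
Proof.
move=> [e e0 cf] c0; exists e => // x /cf H.
apply: (@cvg_unique _ _ (pseries c x @ \oo)) => //.
rewrite (_ : pseries c x = cst 0); first exact: cvg_cst.
by apply/funext => N; rewrite /pseries series_ord big1 // => i _; rewrite /= c0 mul0r.
Qed.

End analytic_at0.

(** * Two solutions of the system coincide *)

Section uniqueness.
Context {R : realType} (r1 r2 m1 m2 : R).
Hypotheses (r1_gt0 : 0 < r1) (r2_gt0 : 0 < r2) (m1_gt0 : 0 < m1) (m2_gt0 : 0 < m2)
  (r_le1 : r1 + r2 <= 1) (m_eq1 : m1 + m2 = 1).

Let rho1 := Num.sqrt (r1 * m1).
Let rho2 := Num.sqrt (r2 * m2).

Lemma sqrt_mul_gt0_lt1 (r m : R) : 0 < r < 1 -> 0 < m < 1 -> 0 < Num.sqrt (r * m) < 1.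
Proof.
move=> /andP[r0 rl] /andP[m0 ml]; rewrite sqrtr_gt0 mulr_gt0 //=.
by rewrite -[X in _ < X]sqrtr1 ltr_sqrt // mulr_ilt1 // ltW.
Qed.

Lemma rho1P : 0 < rho1 < 1.
Proof.
by apply: sqrt_mul_gt0_lt1; apply/andP; split => //; move: r2_gt0 m2_gt0 r_le1 m_eq1; lra.
Qed.

Lemma rho2P : 0 < rho2 < 1.
Proof.
by apply: sqrt_mul_gt0_lt1; apply/andP; split => //; move: r1_gt0 m1_gt0 r_le1 m_eq1; lra.
Qed.

Lemma sqrt_mul_le_mean (r m : R) : 0 < r -> 0 < m -> Num.sqrt (r * m) <= (r + m) / 2.
Proof.
move=> r0 m0; have rm0 : 0 <= (r + m) / 2 by rewrite divr_ge0 // addr_ge0 // ltW.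
rewrite -[leRHS]ger0_norm // -sqrtr_sqr.
rewrite ler_sqrt ?sqr_ge0 //; have := sqr_ge0 (r - m); rewrite sqrrB expr_div_n sqrrD; lra.
Qed.

(** By the inequality of arithmetic and geometric means, the sum is at most (r1 + m1 + r2 + m2) /
    2. *)
Lemma rhoD_le1 : rho1 + rho2 <= 1.
Proof.
have := sqrt_mul_le_mean r1_gt0 m1_gt0; have := sqrt_mul_le_mean r2_gt0 m2_gt0.
by move: r_le1 m_eq1; rewrite -/rho1 -/rho2; lra.
Qed.

(** Since both rho are below 1, an exponent of at least 2 makes the factor of d strictly smaller
    than a1 rho1 + a2 rho2, hence smaller than 1. *)
Lemma contraction_eq0 (d a1 a2 : R) (n : nat) : 0 < a1 * rho1 -> 0 < a2 * rho2 ->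
  a1 * rho1 + a2 * rho2 <= 1 ->
  d = (a1 * rho1 ^+ n.+2 + a2 * rho2 ^+ n.+2) * d -> d = 0.
Proof.
rewrite ![_ ^+ n.+2]exprS !mulrA.
move: (a1 * rho1) (a2 * rho2) => x1 x2 x10 x20 xle.
have /andP[p1 l1] := rho1P; have /andP[p2 l2] := rho2P.
have b1 : x1 * rho1 ^+ n.+1 < x1 by rewrite gtr_pMr // exprn_ilt1 // ltW.
have b2 : x2 * rho2 ^+ n.+1 < x2 by rewrite gtr_pMr // exprn_ilt1 // ltW.
set t := (_ + _) => dt; have t1 : 1 - t != 0 by rewrite /t; apply: lt0r_neq0; lra.
by apply: (mulfI t1); rewrite mulr0 mulrBl mul1r -dt subrr.
Qed.

Variables (f1 f2 g1 g2 h1 h2 k1 k2 : R -> R).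
Hypotheses (fc : trig_conditions f1 f2 g1 g2) (fs : trig_system r1 r2 m1 m2 f1 f2 g1 g2).
Hypotheses (hc : trig_conditions h1 h2 k1 k2) (hs : trig_system r1 r2 m1 m2 h1 h2 k1 k2).

Lemma trig_solutions_coef : exists c1 c2 d1 d2 : nat -> R,
  [/\ expansion0 c1 (fun x => f1 x - h1 x), expansion0 c2 (fun x => f2 x - h2 x),
      expansion0 d1 (fun x => g1 x - k1 x), expansion0 d2 (fun x => g2 x - k2 x)
    & forall n, [/\ c1 n = 0, c2 n = 0, d1 n = 0 & d2 n = 0]].
Proof.
have [[af1 af2 ag1 ag2] [of1 of2 eg1 eg2] [lf1 lf2] [g10 g20]] := fc.
have [[ah1 ah2 ak1 ak2] [oh1 oh2 ek1 ek2] [lh1 lh2] [k10 k20]] := hc.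
have [cf1 xf1] := real_analytic_expansion0 af1.
have [cf2 xf2] := real_analytic_expansion0 af2.
have [cg1 xg1] := real_analytic_expansion0 ag1.
have [cg2 xg2] := real_analytic_expansion0 ag2.
have [ch1 xh1] := real_analytic_expansion0 ah1.
have [ch2 xh2] := real_analytic_expansion0 ah2.
have [ck1 xk1] := real_analytic_expansion0 ak1.
have [ck2 xk2] := real_analytic_expansion0 ak2.
have D1 := expansion0B xf1 xh1; have D2 := expansion0B xf2 xh2.
have D3 := expansion0B xg1 xk1; have D4 := expansion0B xg2 xk2.
eexists _, _, _, _; split; [exact: D1|exact: D2|exact: D3|exact: D4|].
have odd0 (f : R -> R) : odd_fun f -> f 0 = 0.
  by move=> /(_ 0); rewrite oppr0 => /eqP; rewrite -addr_eq0 -mulr2n mulrn_eq0 /= => /eqP.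
have f10 := odd0 _ of1; have f20 := odd0 _ of2.
have h10 := odd0 _ oh1; have h20 := odd0 _ oh2.
have e1 := expansion0_at0 D1; have e2 := expansion0_at0 D2.
have e3 := expansion0_at0 D3; have e4 := expansion0_at0 D4.
move: e1 e2 e3 e4 => /=; rewrite f10 f20 h10 h20 g10 g20 k10 k20 !subrr => e1 e2 e3 e4.
move: (expansion0_cvg xf1) (expansion0_cvg xf2) (expansion0_cvg xg1) (expansion0_cvg xg2).
rewrite f10 f20 g10 g20 => vf1 vf2 vg1 vg2.
move: (expansion0_cvg xh1) (expansion0_cvg xh2) (expansion0_cvg xk1) (expansion0_cvg xk2).
rewrite h10 h20 k10 k20 => vh1 vh2 vk1 vk2.
have leadE (c : nat -> R) (f : R -> R) n l : expansion0 c f ->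
    (forall m, (m < n)%N -> c m = 0) -> f x / x ^+ n @[x --> 0^'] --> l -> c n = l.
  by move=> cf c0 fl; exact: (cvg_unique _ (expansion0_leading cf c0) fl).
(* Replacing x by -x negates the limit of f x / x, so the coefficient equals its opposite. *)
have even1 (c : nat -> R) (f : R -> R) : expansion0 c f -> c 0%N = 0 -> even_fun f -> c 1%N = 0.
  move=> cf c0 ef.
  have c0' m : (m < 1)%N -> c m = 0 by case: m.
  have N1 : -1 != 0 :> R by rewrite oppr_eq0 oner_eq0.
  have L := expansion0_leading cf c0'.
  have L' : f x / x ^+ 1 @[x --> 0^'] --> (-1) ^+ 1 * c 1%N.
    apply: cvg_trans (cvg_ratio_dilate N1 L).
    by apply: near_eq_cvg; apply: nearW => x; rewrite mulN1r ef.
  have : c 1%N = (-1) ^+ 1 * c 1%N by exact: (cvg_unique _ L L').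
  by rewrite expr1 mulN1r => /eqP; rewrite -addr_eq0 -mulr2n mulrn_eq0 /= => /eqP.
have slope1 (c : nat -> R) (f h : R -> R) : expansion0 c (fun x => f x - h x) -> c 0%N = 0 ->
    f z / z @[z --> 0^'] --> (1 : R) -> h z / z @[z --> 0^'] --> (1 : R) -> c 1%N = 0.
  move=> cf c0 lf lh; apply: (leadE _ _ _ _ cf); first by case.
  have H : f z / z - h z / z @[z --> 0^'] --> (1 : R) - 1 by exact: cvgB.
  rewrite subrr in H; apply: cvg_trans H; apply: near_eq_cvg; apply: nearW => x.
  by rewrite expr1 mulrBl.
have /andP[p1 l1] := rho1P; have /andP[p2 l2] := rho2P.
have n1 := lt0r_neq0 p1; have n2 := lt0r_neq0 p2.
elim/ltn_ind => -[_|[_|n IH]]; first by [].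
  split.
  - exact: slope1 D1 _ lf1 lh1.
  - exact: slope1 D2 _ lf2 lh2.
  - by apply: even1 D3 _ _ => // z; rewrite eg1 ek1.
  - by apply: even1 D4 _ _ => // z; rewrite eg2 ek2.
have lo1 m : (m < n.+2)%N -> cf1 m - ch1 m = 0 by move=> /IH[].
have lo2 m : (m < n.+2)%N -> cf2 m - ch2 m = 0 by move=> /IH[].
have lo3 m : (m < n.+2)%N -> cg1 m - ck1 m = 0 by move=> /IH[].
have lo4 m : (m < n.+2)%N -> cg2 m - ck2 m = 0 by move=> /IH[].
have L1 := expansion0_leading D1 lo1; have L2 := expansion0_leading D2 lo2.
have L3 := expansion0_leading D3 lo3; have L4 := expansion0_leading D4 lo4.
(* In [contraction_eq0] the bound a1 rho1 + a2 rho2 is thus m1 + m2 for the first equation and r1 +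
   r2 for the second; for the cosines it is rho1 + rho2. *)
have R1 : Num.sqrt (m1 / r1) * rho1 = m1.
  by rewrite -sqrtrM ?divr_ge0 ?ltW // mulrA divfK ?lt0r_neq0 // -expr2 sqrtr_sqr gtr0_norm.
have R2 : Num.sqrt (m2 / r2) * rho2 = m2.
  by rewrite -sqrtrM ?divr_ge0 ?ltW // mulrA divfK ?lt0r_neq0 // -expr2 sqrtr_sqr gtr0_norm.
have R1' : Num.sqrt (r1 / m1) * rho1 = r1.
  rewrite /rho1 mulrC -sqrtrM ?mulr_ge0 ?ltW // mulrA mulrAC mulfK ?lt0r_neq0 //.
  by rewrite -expr2 sqrtr_sqr gtr0_norm.
have R2' : Num.sqrt (r2 / m2) * rho2 = r2.
  rewrite /rho2 mulrC -sqrtrM ?mulr_ge0 ?ltW // mulrA mulrAC mulfK ?lt0r_neq0 //.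
  by rewrite -expr2 sqrtr_sqr gtr0_norm.
(* The sines vanish at 0 and the cosines are 1 there, so the limits decouple: each equation keeps
   only the n-th coefficient of the function on its left-hand side. *)
split.
- apply: (@contraction_eq0 _ (Num.sqrt (m1 / r1)) (Num.sqrt (m2 / r2)) n);
    rewrite ?R1 ?R2 ?m_eq1 //.
  have := cvg_linear_system L1
    (cvg_ratio_product n1 n2 L1 L4 vh1 vg2)
    (cvg_ratio_product n1 n2 L3 L1 vk1 vf1)
    (cvg_ratio_product n1 n2 L1 L1 vh1 vf1).
  move=> /(_ (Num.sqrt (m1 / r1)) (Num.sqrt (m2 / r2))
    (- (1 - (r1 + r2)) * Num.sqrt ((m1 * m2) / (r1 * r2)))) E; rewrite {1}E.
    by ring.
  move=> z z0; have [-> _ _ _] := fs z; have [-> _ _ _] := hs z.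
  by rewrite -/rho1 -/rho2; move: (z ^+ n.+2) (expf_neq0 n.+2 z0) => t t0; field.
- apply: (@contraction_eq0 _ (Num.sqrt (r1 / m1)) (Num.sqrt (r2 / m2)) n);
    rewrite ?R1' ?R2' //.
  have := cvg_linear_system L2
    (cvg_ratio_product n1 n2 L2 L3 vh2 vg1)
    (cvg_ratio_product n1 n2 L4 L2 vk2 vf2)
    (cvg_ratio_product n1 n2 L4 L3 vk2 vg1).
  move=> /(_ (Num.sqrt (r1 / m1)) (Num.sqrt (r2 / m2)) (1 - (r1 + r2))) E; rewrite {1}E.
    by ring.
  move=> z z0; have [_ -> _ _] := fs z; have [_ -> _ _] := hs z.
  by rewrite -/rho1 -/rho2; move: (z ^+ n.+2) (expf_neq0 n.+2 z0) => t t0; field.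
- apply: (@contraction_eq0 _ 1 1 n); rewrite ?mul1r //; first exact: rhoD_le1.
  have := cvg_linear_system L3
    (cvg_ratio_product n1 n2 L3 L3 vk1 vg1)
    (cvg_ratio_product n1 n2 L1 L2 vh1 vf2)
    (cvg_ratio_product n1 n2 L1 L3 vh1 vg1).
  move=> /(_ 1 (- Num.sqrt ((r2 * m1) / (r1 * m2)))
     (- (1 - (r1 + r2)) * Num.sqrt (m1 / r1))) E; rewrite {1}E.
    by ring.
  move=> z z0; have [_ _ -> _] := fs z; have [_ _ -> _] := hs z.
  by rewrite -/rho1 -/rho2; move: (z ^+ n.+2) (expf_neq0 n.+2 z0) => t t0; field.
- apply: (@contraction_eq0 _ 1 1 n); rewrite ?mul1r //; first exact: rhoD_le1.
  have := cvg_linear_system L4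
    (cvg_ratio_product n1 n2 L4 L4 vk2 vg2)
    (cvg_ratio_product n1 n2 L2 L1 vh2 vf1)
    (cvg_ratio_product n1 n2 L4 L1 vk2 vf1).
  move=> /(_ 1 (- Num.sqrt ((r1 * m2) / (r2 * m1)))
     (- (1 - (r1 + r2)) * Num.sqrt (m2 / r2))) E; rewrite {1}E.
    by ring.
  move=> z z0; have [_ _ _ ->] := fs z; have [_ _ _ ->] := hs z.
  by rewrite -/rho1 -/rho2; move: (z ^+ n.+2) (expf_neq0 n.+2 z0) => t t0; field.
Qed.

Lemma trig_solutions_eq : [/\ f1 = h1, f2 = h2, g1 = k1 & g2 = k2].
Proof.
have [c1 [c2 [d1 [d2 [D1 D2 D3 D4 cd0]]]]] := trig_solutions_coef.
have [e1 e10 E1] := expansion0_eq0 D1 (fun n => let: And4 a _ _ _ := cd0 n in a).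
have [e2 e20 E2] := expansion0_eq0 D2 (fun n => let: And4 _ a _ _ := cd0 n in a).
have [e3 e30 E3] := expansion0_eq0 D3 (fun n => let: And4 _ _ a _ := cd0 n in a).
have [e4 e40 E4] := expansion0_eq0 D4 (fun n => let: And4 _ _ _ a := cd0 n in a).
pose e := Num.min (Num.min e1 e2) (Num.min e3 e4).
have e0 : 0 < e by rewrite !lt_min e10 e20 e30 e40.
pose rho := Num.max rho1 rho2.
have /andP[p1 l1] := rho1P; have /andP[p2 l2] := rho2P.
have rho0 : 0 < rho by rewrite lt_max p1.
have rho_lt1 : rho < 1 by rewrite gt_max l1.
(* Both contracted points have modulus at most rho |z|, so each use of the system enlarges the
   interval of equality by a factor 1 / rho. *)
have eq_scale k z : rho ^+ k * `|z| < e -> [/\ f1 z = h1 z, f2 z = h2 z, g1 z = k1 z & g2 z = k2 z].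
  elim: k z => [|k IH] z.
    rewrite expr0 mul1r !lt_min => /andP[/andP[z1 z2] /andP[z3 z4]].
    by split; apply/eqP; rewrite -subr_eq0; apply/eqP; [exact: E1|exact: E2|exact: E3|exact: E4].
  rewrite exprSr -mulrA => ze.
  have sub r : 0 < r -> r <= rho -> rho ^+ k * `|r * z| < e.
    move=> r0 rr; apply: le_lt_trans ze; rewrite ler_wpM2l ?exprn_ge0 ?(ltW rho0) //.
    by rewrite normrM (gtr0_norm r0) ler_wpM2r.
  have [] := IH _ (sub rho1 p1 _); first by rewrite le_max lexx.
  move=> a1 a2 a3 a4.
  have [] := IH _ (sub rho2 p2 _); first by rewrite le_max lexx orbT.
  move=> b1 b2 b3 b4.
  have [-> -> -> ->] := fs z; have [-> -> -> ->] := hs z.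
  by rewrite -/rho1 -/rho2 a1 a2 a3 a4 b1 b2 b3 b4.
have eq_all z : [/\ f1 z = h1 z, f2 z = h2 z, g1 z = k1 z & g2 z = k2 z].
  have [k kz] : exists k, rho ^+ k * `|z| < e.
    have H : rho ^+ k * `|z| @[k --> \oo] --> 0 * `|z|.
      by apply: cvgMr_tmp; apply: cvg_expr; rewrite gtr0_norm.
    rewrite mul0r in H; have /cvgrPdist_lt /(_ e e0)[N _ /(_ N (leqnn _))] := H.
    rewrite /= sub0r normrN ger0_norm ?mulr_ge0 ?exprn_ge0 ?(ltW rho0) // => NN.
    by exists N.
  exact: eq_scale kz.
by split; apply/funext => z; have [] := eq_all z.
Qed.

End uniqueness.

(** * The trigonometric functions of mu *)

Section interleaved_series.
Context {R : realType}.

(** Interleaving with zeros turns a series in even, or below in odd, powers into an ordinary power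
    series, the form that [real_analytic] refers to. *)
Lemma pseries_even_cvg (a : nat -> R) (l : R) z :
  series (fun n => a n * z ^+ n.*2) @ \oo --> l ->
  pseries (fun m => if odd m then 0 else a m./2) z @ \oo --> l.
Proof.
move=> ca.
have c0 : series (fun=> 0 : R) @ \oo --> (0 : R).
  rewrite (_ : series _ = cst 0); first exact: cvg_cst.
  by apply/funext => N; rewrite series_ord big1.
have := interleave_cvg ca c0; rewrite addr0.
rewrite (_ : series _ = pseries (fun m => if odd m then 0 else a m./2) z) //.
congr series; apply/funext => m /=; case: ifPn => om; first by rewrite mul0r.
by rewrite even_halfK.
Qed.

Lemma pseries_odd_cvg (a : nat -> R) (l : R) z :
  series (fun n => a n * z ^+ n.*2.+1) @ \oo --> l ->
  pseries (fun m => if odd m then a m./2 else 0) z @ \oo --> l.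
Proof.
move=> ca.
have c0 : series (fun=> 0 : R) @ \oo --> (0 : R).
  rewrite (_ : series _ = cst 0); first exact: cvg_cst.
  by apply/funext => N; rewrite series_ord big1.
have := interleave_cvg c0 ca; rewrite add0r.
rewrite (_ : series _ = pseries (fun m => if odd m then a m./2 else 0) z) //.
congr series; apply/funext => m /=; case: ifPn => om; last by rewrite mul0r.
by rewrite odd_halfK // prednK // odd_gt0.
Qed.

Lemma psum_cvg_analytic (a : nat -> R) (f : R -> R) :
  (forall z, pseries a z @ \oo --> f z) -> real_analytic f.
Proof.
move=> af; have ea : entire a by move=> z; apply/cvgP; exact: af.
rewrite (_ : f = psum a); first exact: entire_analytic.
by apply/funext => z; apply/esym; exact: cvg_lim.
Qed.

End interleaved_series.

Section trig_functions.
Context {R : realType} (mu : probability (measurableTypeR R) R).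

Lemma even_series_cvg c z :
  series (fun n => (-1) ^+ n * word mu c n.*2 1 * z ^+ n.*2) @ \oo -->
  psum (even_word mu c) (- z ^+ 2).
Proof.
rewrite (_ : series _ = pseries (even_word mu c) (- z ^+ 2)); first exact: even_word_entire.
congr series; apply/funext => n /=.
by rewrite /even_word [(- z ^+ 2) ^+ n]exprNn -exprM mul2n mulrCA mulrA.
Qed.

Lemma odd_series_cvg c z :
  series (fun n => (-1) ^+ n * word mu c n.*2.+1 1 * z ^+ n.*2.+1) @ \oo -->
  z * psum (odd_word mu c) (- z ^+ 2).
Proof.
rewrite (_ : series _ = fun N => z * pseries (odd_word mu c) (- z ^+ 2) N).
  by apply: cvgMl_tmp; exact: odd_word_entire.
apply/funext => N; rewrite /pseries !series_ord mulr_sumr; apply: eq_bigr => n _.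
by rewrite /= /odd_word /= [(- z ^+ 2) ^+ n]exprNn -exprM mul2n exprS; ring.
Qed.

(** The outermost letter is mu for p_n with n odd and q_n with n even, and Lebesgue in the other two
    cases; hence the sine and the cosine of one type carry opposite letters. *)
Lemma sin_muNE z : sin_muN mu z = z * psum (odd_word mu true) (- z ^+ 2).
Proof.
rewrite /sin_muN; under [in X in limn X]eq_fun do rewrite pfun_word /= odd_double.
by apply: cvg_lim => //; exact: odd_series_cvg.
Qed.

Lemma sin_muDE z : sin_muD mu z = z * psum (odd_word mu false) (- z ^+ 2).
Proof.
rewrite /sin_muD; under [in X in limn X]eq_fun do rewrite qfun_word /= odd_double.
by apply: cvg_lim => //; exact: odd_series_cvg.
Qed.

Lemma cos_muNE z : cos_muN mu z = psum (even_word mu false) (- z ^+ 2).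
Proof.
rewrite /cos_muN; under [in X in limn X]eq_fun do rewrite pfun_word odd_double.
by apply: cvg_lim => //; exact: even_series_cvg.
Qed.

Lemma cos_muDE z : cos_muD mu z = psum (even_word mu true) (- z ^+ 2).
Proof.
rewrite /cos_muD; under [in X in limn X]eq_fun do rewrite qfun_word odd_double.
by apply: cvg_lim => //; exact: even_series_cvg.
Qed.

Lemma psum_at0 (a : nat -> R) : psum a 0 = a 0%N.
Proof. by apply: cvg_lim => //; exact: pseries_at0_cvg. Qed.

Lemma even_series_analytic c : real_analytic (fun z => psum (even_word mu c) (- z ^+ 2)).
Proof.
apply: (@psum_cvg_analytic _ (fun m =>
  if odd m then 0 else (-1) ^+ m./2 * word mu c m./2.*2 1)) => z.
exact: (pseries_even_cvg (even_series_cvg (c := c) (z := z))).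
Qed.

Lemma odd_series_analytic c : real_analytic (fun z => z * psum (odd_word mu c) (- z ^+ 2)).
Proof.
apply: (@psum_cvg_analytic _ (fun m =>
  if odd m then (-1) ^+ m./2 * word mu c m./2.*2.+1 1 else 0)) => z.
exact: (pseries_odd_cvg (odd_series_cvg (c := c) (z := z))).
Qed.

(** Both measures give mass 1 to [0, 1]; this is the slope of the sines at 0. *)
Lemma word1_at1 c : mu `[0, 1]%classic = 1%E -> word mu c 1 1 = 1.
Proof.
move=> mu01; rewrite /= /iint; case: c; rewrite Rintegral_cst // mul1r.
  exact: (congr1 fine mu01).
have leb01 : (@lebesgue_measure R `[0%R, 1%R]%classic = 1)%E.
  by rewrite lebesgue_measure_itv /= lte_fin ltr01 -EFinB subr0.
exact: (congr1 fine leb01).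
Qed.

Lemma odd_series_slope c : mu `[0, 1]%classic = 1%E ->
  (z * psum (odd_word mu c) (- z ^+ 2)) / z @[z --> (0 : R)^'] --> (1 : R).
Proof.
move=> mu01.
pose a m := if odd m then (-1) ^+ m./2 * word mu c m./2.*2.+1 1 else 0.
have := @pseries_leading R a (fun z => z * psum (odd_word mu c) (- z ^+ 2)) 1 1 ltr01.
have -> : a 1%N = 1 by exact: etrans (mul1r _) (word1_at1 c mu01).
apply.
- by move=> z _; exact: (pseries_odd_cvg (odd_series_cvg (c := c) (z := z))).
- by case.
Qed.

Lemma trig_mu_conditions : mu `[0, 1]%classic = 1%E ->
  trig_conditions (sin_muN mu) (sin_muD mu) (cos_muN mu) (cos_muD mu).
Proof.
move=> mu01.
rewrite (funext sin_muNE) (funext sin_muDE) (funext cos_muNE) (funext cos_muDE).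
split.
- by split; [exact: odd_series_analytic|exact: odd_series_analytic|
             exact: even_series_analytic|exact: even_series_analytic].
- by split=> z; rewrite ?mulNr sqrrN.
- by split; exact: odd_series_slope.
- by rewrite !expr0n /= oppr0 !psum_at0.
Qed.

Section system.
Variables (r1 r2 m1 m2 : R).
Hypotheses (r1_gt0 : 0 < r1) (r2_gt0 : 0 < r2) (m1_gt0 : 0 < m1) (m2_gt0 : 0 < m2)
  (r_le1 : r1 + r2 <= 1) (m_eq1 : m1 + m2 = 1) (mu_ss : self_similar r1 r2 m1 m2 mu).

Lemma trig_mu_system :
  trig_system r1 r2 m1 m2 (sin_muN mu) (sin_muD mu) (cos_muN mu) (cos_muD mu).
Proof.
have wE := even_wordE r1_gt0 r2_gt0 m1_gt0 m2_gt0 r_le1 m_eq1 mu_ss.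
have wO := odd_wordE r1_gt0 r2_gt0 m1_gt0 m2_gt0 r_le1 m_eq1 mu_ss.
move=> z /=.
have sq r m : 0 < r -> 0 < m -> - (Num.sqrt (r * m) * z) ^+ 2 = r * m * - z ^+ 2.
  by move=> r0 m0; rewrite exprMn sqr_sqrtr ?mulrN // ltW // mulr_gt0.
rewrite !sin_muNE !sin_muDE !cos_muNE !cos_muDE !sq //.
(* Writing the four parameters as squares turns every root of the system into a rational expression,
   within reach of [field]. *)
have [a a0 r1E] : exists2 a, 0 < a & r1 = a ^+ 2.
  by exists (Num.sqrt r1); rewrite ?sqrtr_gt0 ?sqr_sqrtr // ltW.
have [b b0 r2E] : exists2 a, 0 < a & r2 = a ^+ 2.
  by exists (Num.sqrt r2); rewrite ?sqrtr_gt0 ?sqr_sqrtr // ltW.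
have [p p0 m1E] : exists2 a, 0 < a & m1 = a ^+ 2.
  by exists (Num.sqrt m1); rewrite ?sqrtr_gt0 ?sqr_sqrtr // ltW.
have [q q0 m2E] : exists2 a, 0 < a & m2 = a ^+ 2.
  by exists (Num.sqrt m2); rewrite ?sqrtr_gt0 ?sqr_sqrtr // ltW.
have sqrtE x y : 0 < x -> x ^+ 2 = y -> Num.sqrt y = x.
  by move=> x0 <-; rewrite sqrtr_sqr gtr0_norm.
have an := lt0r_neq0 a0; have bn := lt0r_neq0 b0.
have pn := lt0r_neq0 p0; have qn := lt0r_neq0 q0.
have -> : Num.sqrt (r1 * m1) = a * p.
  by apply: sqrtE; rewrite ?mulr_gt0 // r1E m1E; ring.
have -> : Num.sqrt (r2 * m2) = b * q.
  by apply: sqrtE; rewrite ?mulr_gt0 // r2E m2E; ring.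
have -> : Num.sqrt (m1 / r1) = p / a.
  by apply: sqrtE; rewrite ?divr_gt0 // r1E m1E; field.
have -> : Num.sqrt (m2 / r2) = q / b.
  by apply: sqrtE; rewrite ?divr_gt0 // r2E m2E; field.
have -> : Num.sqrt (r1 / m1) = a / p.
  by apply: sqrtE; rewrite ?divr_gt0 // r1E m1E; field.
have -> : Num.sqrt (r2 / m2) = b / q.
  by apply: sqrtE; rewrite ?divr_gt0 // r2E m2E; field.
have -> : Num.sqrt ((m1 * m2) / (r1 * r2)) = (p * q) / (a * b).
  by apply: sqrtE; rewrite ?divr_gt0 ?mulr_gt0 // r1E m1E r2E m2E; field; rewrite an bn.
have -> : Num.sqrt ((r2 * m1) / (r1 * m2)) = (b * p) / (a * q).
  by apply: sqrtE; rewrite ?divr_gt0 ?mulr_gt0 // r1E m1E r2E m2E; field; rewrite an qn.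
have -> : Num.sqrt ((r1 * m2) / (r2 * m1)) = (a * q) / (b * p).
  by apply: sqrtE; rewrite ?divr_gt0 ?mulr_gt0 // r1E m1E r2E m2E; field; rewrite bn pn.
(* The system is now the four generating function identities at y = -z^2; the values at the
   contracted points are generalised to plain variables. *)
rewrite (wO true (- z ^+ 2)) (wO false (- z ^+ 2)) (wE true (- z ^+ 2)) (wE false (- z ^+ 2)).
rewrite /gap_even /gap_odd /=.
move: (psum (odd_word mu true) (r1 * m1 * _)) (psum (odd_word mu true) (r2 * m2 * _)) => Ot1 Ot2.
move: (psum (odd_word mu false) (r1 * m1 * _)) (psum (odd_word mu false) (r2 * m2 * _)) => Of1 Of2.
move: (psum (even_word mu true) (r1 * m1 * _)) (psum (even_word mu true) (r2 * m2 * _)) => Et1 Et2.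
move: (psum (even_word mu false) (r1 * m1 * _)) (psum (even_word mu false) (r2 * m2 * _)) => Ef1 Ef2.
rewrite r1E r2E m1E m2E.
by split; field; rewrite ?an ?bn ?pn ?qn.
Qed.
End system.
End trig_functions.

Theorem theorem7p14 (R : realType) (r1 r2 m1 m2 : R)
  (r1_gt0 : 0 < r1) (r2_gt0 : 0 < r2) (m1_gt0 : 0 < m1) (m2_gt0 : 0 < m2)
  (r_le1 : r1 + r2 <= 1) (m_eq1 : m1 + m2 = 1)
  (mu : probability (measurableTypeR R) R)
  (mu_ss : self_similar r1 r2 m1 m2 mu) :
  [/\ trig_system r1 r2 m1 m2 (sin_muN mu) (sin_muD mu) (cos_muN mu) (cos_muD mu),
      trig_conditions (sin_muN mu) (sin_muD mu) (cos_muN mu) (cos_muD mu)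
    & forall f1 f2 g1 g2 : R -> R,
        trig_conditions f1 f2 g1 g2 ->
        trig_system r1 r2 m1 m2 f1 f2 g1 g2 ->
        [/\ f1 = sin_muN mu, f2 = sin_muD mu, g1 = cos_muN mu & g2 = cos_muD mu]].
Proof.
have sys := trig_mu_system r1_gt0 r2_gt0 m1_gt0 m2_gt0 r_le1 m_eq1 mu_ss.
have conds := trig_mu_conditions mu_ss.1.
split=> // f1 f2 g1 g2 fc fs.
exact: (trig_solutions_eq r1_gt0 r2_gt0 m1_gt0 m2_gt0 r_le1 m_eq1 fc fs conds sys).
Qed.
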